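(* In the network linear-quadratic model described in the context, assume that $M_0,M_1,M_2,M_3$ solve the system (M) of the context, and let $(P,p)$ solve the reduced Riccati equations (R) of the context. Let $(\widehat{\mathbf X},\widehat u)$ be the state-control pair defined by $$\widehat u_s=-\mathcal B^\top(P_s\widehat{\mathbf X}_s+p_s),\qquad d\widehat{\mathbf X}_s=(\mathcal A_s\widehat{\mathbf X}_s+\mathcal B\widehat u_s)ds+\bar\Sigma_sdW_s,\quad \widehat{\mathbf X}_t=\begin{pmatrix}x\\0\end{pmatrix},\qquad s\in[t,T].$$ If $\widehat u\in\mathscr A^{(N)}$, then $$F_s^{\widehat u}=\mathcal T\,\widehat{\mathbf X}_s,\qquad s\in[t,T],$$ and $$\widehat u_s=-K_sF_s^{\widehat u}-\widetilde I\,M_2(s),\qquad s\in[t,T].$$ Equivalently, $\widehat u$ satisfies the feedback relation $\widehat u^{\rm ref}_s=-K_s\widehat F_s-\widetilde IM_2(s)$ with $\widehat u^{\rm ref}=\widehat u$ and $\widehat F_s=F_s^{\widehat u}$. Consequently, the feedback control obtained from the reduced finite-dimensional linear-quadratic problem coincides with the feedback control defined by this relation (the one from the conditional McKean--Vlasov formulation).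
   Context: **Model.** $W=(W_1,\dots,W_N)^\top$ is an $N$-dimensional Brownian motion on a complete probability space with completed natural filtration $\mathbb F=(\mathcal F_s)_{s\in[t,T]}$; $t\in[0,T]$, $x=(x_1,\dots,x_N)^\top\in\mathbb R^N$. For $i=1,\dots,N$: $dX_{i,s}^u=(a_i(s)X_{i,s}^u+u_{i,s})ds+\sigma_i(s)dW_{i,s}$, $X_{i,t}^u=x_i$, with $a_i,\sigma_i\in C([0,T];\mathbb R)$, and cost $$J_i^{t,x}(u)=\mathbb E\Big[\int_t^T\Big(u_{i,s}^2+\tfrac1N\sum_{j=1}^Nq_{ij}(X_{i,s}^u-X_{j,s}^u)^2\Big)ds+\gamma_i(X_{i,T}^u-d_i)^2\Big],$$ $q_{ij}\ge0$, $\gamma_i\ge0$, $d_i\in\mathbb R$. Let $\mathcal H^2([t,T];\mathbb R)$ be the progressively measurable processes with $\|v\|_{\mathcal H^2}^2=\mathbb E\int_t^T|v_s|^2ds<\infty$; $\mathscr A_i=\{u_i\in\mathcal H^2([t,T];\mathbb R):\|u_i\|_{\mathcal H^2}\le L\}$ for a sufficiently large constant $L>0$, $\mathscr A^{(N)}=\prod_i\mathscr A_i$. The variational process $Y^u=(Y_1^u,\dots,Y_N^u)^\top$ solves $dY_{i,s}^u=(a_i(s)Y_{i,s}^u+u_{i,s})ds$, $Y_{i,t}^u=0$. **The process $F^u$.** $\tau$ is uniform on $[0,1]$, independent of $\mathcal F_T$; $X^{\tau u}$ is the state with control $\tau u$; $\mathbb X_s^{\tau,u}=\begin{pmatrix}X_s^{\tau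 u}\\ Y_s^u\end{pmatrix}\in\mathbb R^{2N}$; $F_s^u=\begin{pmatrix}\mathbb E[\mathbb X_s^{\tau,u}\mid\mathcal F_s]\\ \mathbb E[\tau\mathbb X_s^{\tau,u}\mid\mathcal F_s]\end{pmatrix}\in\mathbb R^{4N}$. **Matrices.** $A_s^N=\operatorname{diag}(a_1(s),\dots,a_N(s))$, $\Sigma_s^N=\operatorname{diag}(\sigma_1(s),\dots,\sigma_N(s))$, $\mathcal A_s=\operatorname{diag}(A_s^N,A_s^N)$, $\mathbb A_s=\operatorname{diag}(\mathcal A_s,\mathcal A_s)$, $\bar\Sigma_s=\begin{pmatrix}\Sigma_s^N\\0\end{pmatrix}$, $\mathcal B=\begin{pmatrix}I_N\\ I_N\end{pmatrix}$, $\widetilde I=(\frac12I_N,I_N,\frac13I_N,\frac12I_N)$, $\mathcal J=\begin{pmatrix}I_{2N}\\ \frac12I_{2N}\end{pmatrix}$. $\widetilde Q\in\mathbb R^{N\times N}$: $\widetilde Q_{ii}=\frac1N\sum_{k\ne i}q_{ik}$, $\widetilde Q_{ij}=-\frac{q_{ij}}N$ for $i\neq j$. $\Gamma=\operatorname{diag}(\gamma_1,\dots,\gamma_N)$, $d=(d_1,\dots,d_N)^\top$. $$Q=\begin{pmatrix}0&\widetilde Q^\top\\ \widetilde Q&0\end{pmatrix},\quad\bar Q=\begin{pmatrix}0&\Gamma\\ \Gamma&0\end{pmatrix},\quad p_0=-\begin{pmatrix}0\\ \Gamma d\end{pmatrix},\quad\mathcal T=\begin{pmatrix}I_N&-\frac12I_N\\0&I_N\\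 \frac12I_N&-\frac16I_N\\0&\frac12I_N\end{pmatrix},$$ $$\mathcal Q=\begin{pmatrix}0&\widetilde Q^\top\\ \widetilde Q&-\frac12(\widetilde Q+\widetilde Q^\top)\end{pmatrix},\quad\mathcal G=\begin{pmatrix}0&\Gamma\\ \Gamma&-\Gamma\end{pmatrix},\quad\mathfrak g=-\begin{pmatrix}0\\ \Gamma d\end{pmatrix}.$$ **System (M)** on $[t,T]$, with $M_0\in\mathbb R^{2N\times2N}$, $M_1\in\mathbb R^{4N\times4N}$, $M_2\in\mathbb R^{4N}$, $M_3\in\mathbb R$ and $K=\big((0,I_N)M_0,(I_N,0)M_0\big)+\widetilde IM_1\in\mathbb R^{N\times4N}$: $\dot M_0+\mathcal A^\top M_0+M_0\mathcal A+Q=0$, $M_0(T)=\bar Q$; $\dot M_1+\mathbb A^\top M_1+M_1\mathbb A-K^\top K=0$, $M_1(T)=0$; $\dot M_2+\mathbb A^\top M_2-K^\top\widetilde IM_2=0$, $M_2(T)=\begin{pmatrix}p_0\\0\end{pmatrix}$; $\dot M_3+\operatorname{tr}(\bar\Sigma\bar\Sigma^\top[M_0+\mathcal J^\top M_1\mathcal J])-(\widetilde IM_2)^\top(\widetilde IM_2)=0$, $M_3(T)=0$. **Reduced equations (R)** on $[t,T]$: $\dot P+\mathcal A^\top P+P\mathcal A+\mathcal Q-P\mathcal B\mathcal B^\top P=0$, $P_T=\mathcal G$; $\dot p+\mathcal A^\top p-P\mathcal B\mathcal B^\top p=0$, $p_T=\mathfrak g$. These arise from minimizing $\mathbb E[\int_t^T(u_s^\top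 u_s+\mathbf X_s^\top\mathcal Q\mathbf X_s)ds+\mathbf X_T^\top\mathcal G\mathbf X_T+2\mathfrak g^\top\mathbf X_T]$ over $u\in\mathscr A^{(N)}$, where $d\mathbf X_s=(\mathcal A_s\mathbf X_s+\mathcal Bu_s)ds+\bar\Sigma_sdW_s$, $\mathbf X_t=(x^\top,0)^\top$. *)

(* Defs.v *)
From HB Require Import structures.
From mathcomp Require Export all_boot all_order all_algebra.
From mathcomp Require Export all_classical all_reals all_analysis.
Export numFieldNormedType.Exports.

Set Implicit Arguments.
Unset Strict Implicit.
Unset Printing Implicit Defensive.

Import Order.TTheory GRing.Theory Num.Theory.

Local Open Scope classical_set_scope.
Local Open Scope ring_scope.

(** * Probability *)

(* Mutual independence.  The product rule over the full family gives the one
   over every subfamily, by taking [B k = setT] for the other indices. *)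
Definition mutually_independent (R : realType) (d : measure_display)
    (Omega : measurableType d) (P : probability Omega R) (I : finType)
    (X : I -> Omega -> R) : Prop :=
  forall B : I -> set R, (forall k, measurable (B k)) ->
    P [set w | forall k, B k (X k w)] = (\prod_k P (X k @^-1` B k))%E.

(* Standard N-dimensional Brownian motion on [0, T]; the last argument of
   [normal_prob] is the standard deviation. *)
Record brownian (R : realType) (d : measure_display) (Omega : measurableType d)
    (P : probability Omega R) (N : nat) (T : R)
    (W : 'I_N -> R -> {RV P >-> R}) : Prop := Brownian {
  brownian_start : forall i, {ae P, forall w, W i 0 w = 0};
  brownian_continuous : forall i,
    {ae P, forall w, {within `[0, T], continuous (fun s => W i s w)}};
  brownian_normal : forall i r s, 0 <= r -> r < s -> s <= T ->
    forall B : set R, measurable B ->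
      P ((fun w => W i s w - W i r w) @^-1` B)
      = normal_prob 0 (Num.sqrt (s - r)) B;
  brownian_indep : forall (n : nat) (s : nat -> R),
    0 <= s 0%N -> (forall k, (k < n)%N -> s k <= s k.+1) -> s n <= T ->
    mutually_independent P
      (fun ik : 'I_N * 'I_n => fun w => W ik.1 (s ik.2.+1) w - W ik.1 (s ik.2) w)
}.

Definition completed_natural_filtration (R : realType) (d : measure_display)
    (Omega : measurableType d) (P : probability Omega R) (N : nat)
    (W : 'I_N -> R -> {RV P >-> R}) (s : R) : set (set Omega) :=
  <<s [set A | exists (i : 'I_N) (r : R) (B : set R),
         [/\ 0 <= r <= s, measurable B & A = W i r @^-1` B]]
      `|` P.-negligible >>.

Definition measurable_wrt (R : realType) (d : measure_display)
    (Omega : measurableType d) (G : set (set Omega)) (X : Omega -> R) : Prop :=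
  measurable_fun setT (X : g_sigma_algebraType G -> R).

Definition adapted (R : realType) (d : measure_display)
    (Omega : measurableType d) (F : R -> set (set Omega)) (t T : R) (m : nat)
    (X : R -> Omega -> 'cV[R]_m) : Prop :=
  forall s, t <= s <= T -> forall k,
    measurable_wrt (F s) (fun w => X s w k ord0).

Definition progressively_measurable (R : realType) (d : measure_display)
    (Omega : measurableType d) (F : R -> set (set Omega)) (t T : R)
    (v : R -> Omega -> R) : Prop :=
  forall s, t <= s <= T ->
    measurable_fun (`[t, s] `*` setT)
      (fun z : measurableTypeR R * g_sigma_algebraType (F s) => v z.1 z.2).

(* [Z] is a version of E[X | G]. *)
Definition is_cond_exp (R : realType) (d : measure_display)
    (Omega : measurableType d) (P : probability Omega R)
    (G : set (set Omega)) (X Z : Omega -> R) : Prop :=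
  [/\ P.-integrable setT (EFin \o X),
      P.-integrable setT (EFin \o Z),
      measurable_wrt G Z &
      forall A, G A ->
        (\int[P]_(w in A) (Z w)%:E = \int[P]_(w in A) (X w)%:E)%E].

Definition uniform01 (R : realType) (d : measure_display)
    (Omega : measurableType d) (P : probability Omega R)
    (tau : {RV P >-> R}) : Prop :=
  forall B : set R, measurable B ->
    P (tau @^-1` B) = uniform_prob (@ltr01 R) B.

Definition independent_of (R : realType) (d : measure_display)
    (Omega : measurableType d) (P : probability Omega R)
    (tau : {RV P >-> R}) (G : set (set Omega)) : Prop :=
  forall (A : set Omega) (B : set R), G A -> measurable B ->
    P (A `&` tau @^-1` B) = (P A * P (tau @^-1` B))%E.

(** * Stochastic integrals of deterministic integrands *)

(* A list of triples (c, a, b) stands for the step function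
   sum of c * 1_(]a, b]). *)
Definition step_fun (R : realType) (f : seq (R * R * R)) (r : R) : R :=
  \sum_(e <- f) (if e.1.2 < r <= e.2 then e.1.1 else 0).

Definition step_int (R : realType) (Omega : Type) (W : R -> Omega -> R)
    (f : seq (R * R * R)) (s : R) (w : Omega) : R :=
  \sum_(e <- f) e.1.1 * (W (Num.min e.2 s) w - W (Num.min e.1.2 s) w).

(* [Z s] is the Ito integral of the deterministic function [sigma] against [W]
   over [t, s]: the L^2(P)-limit of the integrals of step functions converging
   to [sigma] in L^2([t, T]), in a version with continuous paths. *)
Definition is_ito_integral (R : realType) (d : measure_display)
    (Omega : measurableType d) (P : probability Omega R) (t T : R)
    (W : R -> Omega -> R) (sigma : R -> R) (Z : R -> Omega -> R) : Prop :=
  [/\ forall s, t <= s <= T -> measurable_fun setT (Z s),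
      {ae P, forall w, {within `[t, T], continuous (fun s => Z s w)}} &
      exists f : nat -> seq (R * R * R),
        [/\ forall n e, e \in f n -> [/\ t <= e.1.2, e.1.2 <= e.2 & e.2 <= T],
            (fun n => \int[lebesgue_measure]_(r in `[t, T])
                        ((step_fun (f n) r - sigma r) ^+ 2)%:E)%E
              @ \oo --> (0 : \bar R)%E &
            forall s, t <= s <= T ->
              (fun n => \int[P]_w
                          ((step_int W (f n) s w - Z s w) ^+ 2)%:E)%E
                @ \oo --> (0 : \bar R)%E]].

Definition is_ito_integral_mx (R : realType) (d : measure_display)
    (Omega : measurableType d) (P : probability Omega R) (N m : nat) (t T : R)
    (W : 'I_N -> R -> {RV P >-> R}) (S : R -> 'M[R]_(m, N))
    (Z : R -> Omega -> 'cV[R]_m) : Prop :=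
  exists I : 'I_m -> 'I_N -> R -> Omega -> R,
    (forall k j,
       is_ito_integral P t T (fun s => W j s) (fun s => S s k j) (I k j)) /\
    (forall s w k, Z s w k ord0 = \sum_j I k j s w).

(* Almost surely, for all s in [t, T],
   X_s = x0 + int_t^s (A_r X_r + b_r) dr + Z_s. *)
Definition integral_equation (R : realType) (d : measure_display)
    (Omega : measurableType d) (P : probability Omega R) (m : nat) (t T : R)
    (A : R -> 'M[R]_m) (b : R -> Omega -> 'cV[R]_m) (Z : R -> Omega -> 'cV[R]_m)
    (x0 : 'cV[R]_m) (X : R -> Omega -> 'cV[R]_m) : Prop :=
  {ae P, forall w, forall k,
    lebesgue_measure.-integrable `[t, T]
      (fun r => ((A r *m X r w + b r w) k ord0)%:E) /\
    forall s, t <= s <= T ->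
      X s w k ord0 = x0 k ord0
        + \int[lebesgue_measure]_(r in `[t, s]) (A r *m X r w + b r w) k ord0
        + Z s w k ord0}.

(* dX_s = (A_s X_s + b_s) ds + S_s dW_s, X_t = x0. *)
Definition solves_sde (R : realType) (d : measure_display)
    (Omega : measurableType d) (P : probability Omega R) (N m : nat) (t T : R)
    (W : 'I_N -> R -> {RV P >-> R}) (A : R -> 'M[R]_m)
    (b : R -> Omega -> 'cV[R]_m) (S : R -> 'M[R]_(m, N))
    (x0 : 'cV[R]_m) (X : R -> Omega -> 'cV[R]_m) : Prop :=
  exists Z, is_ito_integral_mx t T W S Z /\
            integral_equation P t T A b Z x0 X.

(** * Matrices of the model *)

Section Matrices.
Context {R : realType} {N : nat}.

Definition AN (a : 'I_N -> R -> R) (s : R) : 'M[R]_N :=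
  diag_mx (\row_i a i s).

Definition SigmaN (sigma : 'I_N -> R -> R) (s : R) : 'M[R]_N :=
  diag_mx (\row_i sigma i s).

Definition calA (a : 'I_N -> R -> R) (s : R) : 'M[R]_(N + N) :=
  block_mx (AN a s) 0 0 (AN a s).

Definition bbA (a : 'I_N -> R -> R) (s : R) : 'M[R]_((N + N) + (N + N)) :=
  block_mx (calA a s) 0 0 (calA a s).

Definition Sigmabar (sigma : 'I_N -> R -> R) (s : R) : 'M[R]_(N + N, N) :=
  col_mx (SigmaN sigma s) 0.

Definition calB : 'M[R]_(N + N, N) := col_mx 1%:M 1%:M.

Definition Itilde : 'M[R]_(N, (N + N) + (N + N)) :=
  row_mx (row_mx (1 / 2)%:M 1%:M) (row_mx (1 / 3)%:M (1 / 2)%:M).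

Definition calJ : 'M[R]_((N + N) + (N + N), N + N) :=
  col_mx 1%:M (1 / 2)%:M.

Definition Qtilde (q : 'I_N -> 'I_N -> R) : 'M[R]_N :=
  \matrix_(i, j) (if i == j then N%:R^-1 * \sum_(k | k != i) q i k
                  else - (q i j / N%:R)).

Definition Gamma (gamma : 'I_N -> R) : 'M[R]_N := diag_mx (\row_i gamma i).

Definition Qmx (q : 'I_N -> 'I_N -> R) : 'M[R]_(N + N) :=
  block_mx 0 (Qtilde q)^T (Qtilde q) 0.

Definition Qbar (gamma : 'I_N -> R) : 'M[R]_(N + N) :=
  block_mx 0 (Gamma gamma) (Gamma gamma) 0.

Definition p0 (gamma : 'I_N -> R) (d : 'cV[R]_N) : 'cV[R]_(N + N) :=
  - col_mx 0 (Gamma gamma *m d).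

Definition calT : 'M[R]_((N + N) + (N + N), N + N) :=
  col_mx (block_mx 1%:M (- (1 / 2))%:M 0 1%:M)
         (block_mx (1 / 2)%:M (- (1 / 6))%:M 0 (1 / 2)%:M).

Definition calQ (q : 'I_N -> 'I_N -> R) : 'M[R]_(N + N) :=
  block_mx 0 (Qtilde q)^T
           (Qtilde q) (- ((1 / 2) *: (Qtilde q + (Qtilde q)^T))).

Definition calG (gamma : 'I_N -> R) : 'M[R]_(N + N) :=
  block_mx 0 (Gamma gamma) (Gamma gamma) (- Gamma gamma).

Definition gfrak (gamma : 'I_N -> R) (d : 'cV[R]_N) : 'cV[R]_(N + N) :=
  - col_mx 0 (Gamma gamma *m d).

Definition Kmx (M0 : 'M[R]_(N + N)) (M1 : 'M[R]_((N + N) + (N + N))) :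
    'M[R]_(N, (N + N) + (N + N)) :=
  row_mx (row_mx 0 1%:M *m M0) (row_mx 1%:M 0 *m M0) + Itilde *m M1.

End Matrices.

(** * Matrix differential equations on [t, T] *)

Definition mxderiv (R : realType) (m n : nat) (M : R -> 'M[R]_(m, n)) (s : R) :
    'M[R]_(m, n) :=
  \matrix_(i, j) derive1 (fun r => M r i j) s.

(* Continuous on [t, T] and differentiable on ]t, T[.  With a differential
   equation on ]t, T[ whose right-hand side is continuous on [t, T], this is
   the same as a C^1 solution on [t, T] with one-sided derivatives at t, T. *)
Definition regular_on (R : realType) (m n : nat) (t T : R)
    (M : R -> 'M[R]_(m, n)) : Prop :=
  forall i j, {within `[t, T], continuous (fun s => M s i j)} /\
    (forall s, t < s < T -> derivable (fun r => M r i j) s 1).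

Record system_M (R : realType) (N : nat) (t T : R) (a sigma : 'I_N -> R -> R)
    (q : 'I_N -> 'I_N -> R) (gamma : 'I_N -> R) (d : 'cV[R]_N)
    (M0 : R -> 'M[R]_(N + N)) (M1 : R -> 'M[R]_((N + N) + (N + N)))
    (M2 : R -> 'cV[R]_((N + N) + (N + N))) (M3 : R -> R) : Prop :=
  SystemM {
  M0_regular : regular_on t T M0;
  M0_ode : forall s, t < s < T ->
    mxderiv M0 s + (calA a s)^T *m M0 s + M0 s *m calA a s + Qmx q = 0;
  M0_final : M0 T = Qbar gamma;
  M1_regular : regular_on t T M1;
  M1_ode : forall s, t < s < T ->
    mxderiv M1 s + (bbA a s)^T *m M1 s + M1 s *m bbA a s
      - (Kmx (M0 s) (M1 s))^T *m Kmx (M0 s) (M1 s) = 0;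
  M1_final : M1 T = 0;
  M2_regular : regular_on t T M2;
  M2_ode : forall s, t < s < T ->
    mxderiv M2 s + (bbA a s)^T *m M2 s
      - (Kmx (M0 s) (M1 s))^T *m (Itilde *m M2 s) = 0;
  M2_final : M2 T = col_mx (p0 gamma d) 0;
  M3_continuous : {within `[t, T], continuous M3};
  M3_derivable : forall s, t < s < T -> derivable M3 s 1;
  M3_ode : forall s, t < s < T ->
    derive1 M3 s
      + \tr (Sigmabar sigma s *m (Sigmabar sigma s)^T
             *m (M0 s + calJ^T *m M1 s *m calJ))
      - ((Itilde *m M2 s)^T *m (Itilde *m M2 s)) ord0 ord0 = 0;
  M3_final : M3 T = 0
}.

Record reduced_R (R : realType) (N : nat) (t T : R) (a : 'I_N -> R -> R)
    (q : 'I_N -> 'I_N -> R) (gamma : 'I_N -> R) (d : 'cV[R]_N)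
    (P : R -> 'M[R]_(N + N)) (p : R -> 'cV[R]_(N + N)) : Prop :=
  ReducedR {
  P_regular : regular_on t T P;
  P_ode : forall s, t < s < T ->
    mxderiv P s + (calA a s)^T *m P s + P s *m calA a s + calQ q
      - P s *m calB *m calB^T *m P s = 0;
  P_final : P T = calG gamma;
  p_regular : regular_on t T p;
  p_ode : forall s, t < s < T ->
    mxderiv p s + (calA a s)^T *m p s - P s *m calB *m calB^T *m p s = 0;
  p_final : p T = gfrak gamma d
}.

(** * Controls, states and the process F^u *)

(* The i-th component of [u] is progressively measurable with
   H^2-norm at most [L], for every i. *)
Definition admissible (R : realType) (d : measure_display)
    (Omega : measurableType d) (P : probability Omega R)
    (F : R -> set (set Omega)) (t T L : R) (N : nat)
    (u : R -> Omega -> 'cV[R]_N) : Prop :=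
  forall i : 'I_N,
    progressively_measurable F t T (fun s w => u s w i ord0) /\
    (\int[P]_w \int[lebesgue_measure]_(s in `[t, T])
        (`|u s w i ord0| ^+ 2)%:E <= (L ^+ 2)%:E)%E.

Definition is_state (R : realType) (d : measure_display)
    (Omega : measurableType d) (P : probability Omega R) (N : nat) (t T : R)
    (W : 'I_N -> R -> {RV P >-> R}) (a sigma : 'I_N -> R -> R) (x : 'cV[R]_N)
    (u X : R -> Omega -> 'cV[R]_N) : Prop :=
  solves_sde t T W (AN a) u (SigmaN sigma) x X.

Definition is_variation (R : realType) (d : measure_display)
    (Omega : measurableType d) (P : probability Omega R) (N : nat) (t T : R)
    (a : 'I_N -> R -> R) (u Y : R -> Omega -> 'cV[R]_N) : Prop :=
  integral_equation P t T (AN a) u (fun _ _ => 0) 0 Y.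

(* [F] is (a version, at each time, of) the process F^u: conditional
   expectations given [Fil s] of XX and tau XX, where XX = (X^{tau u}, Y^u). *)
Definition is_F (R : realType) (d : measure_display)
    (Omega : measurableType d) (P : probability Omega R) (N : nat) (t T : R)
    (Fil : R -> set (set Omega))
    (W : 'I_N -> R -> {RV P >-> R}) (tau : {RV P >-> R})
    (a sigma : 'I_N -> R -> R) (x : 'cV[R]_N) (u : R -> Omega -> 'cV[R]_N)
    (F : R -> Omega -> 'cV[R]_((N + N) + (N + N))) : Prop :=
  exists X Y : R -> Omega -> 'cV[R]_N,
    [/\ is_state t T W a sigma x (fun s w => tau w *: u s w) X,
        is_variation P t T a u Y &
        forall s, t <= s <= T -> forall k : 'I_(N + N),
          is_cond_exp P (Fil s)
            (fun w => (col_mx (X s w) (Y s w)) k ord0)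
            (fun w => usubmx (F s w) k ord0) /\
          is_cond_exp P (Fil s)
            (fun w => tau w * (col_mx (X s w) (Y s w)) k ord0)
            (fun w => dsubmx (F s w) k ord0)].

(* u_s = - K_s F_s - Itilde M_2(s) almost surely, for every s in [t, T]. *)
Definition feedback_relation (R : realType) (d : measure_display)
    (Omega : measurableType d) (P : probability Omega R) (N : nat) (t T : R)
    (M0 : R -> 'M[R]_(N + N)) (M1 : R -> 'M[R]_((N + N) + (N + N)))
    (M2 : R -> 'cV[R]_((N + N) + (N + N)))
    (u : R -> Omega -> 'cV[R]_N)
    (F : R -> Omega -> 'cV[R]_((N + N) + (N + N))) : Prop :=
  forall s, t <= s <= T ->
    {ae P, forall w, u s w = - (Kmx (M0 s) (M1 s) *m F s w) - Itilde *m M2 s}.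

(* Main.v *)
From HB Require Import structures.
Require Import Defs.
From mathcomp Require Import measurable_realfun ring lra.

(** Let [u] be an admissible control, [X] its state with control [tau * u] and
    [Y] its variational process.  The processes [Y - Xhat2] and
    [X + (1 - tau) * Y - Xhat1], where [Xhat1] and [Xhat2] are the two halves of
    [Xhat], solve the same linear equation without noise: the stochastic
    integrals cancel ([ito_integral_unique]), and in the second one the weights
    [tau] and [1 - tau] of the control add up to one.  Hence both are equal to
    the response [V] of the linear system to the difference [u - uhat]
    ([path_representation], by [variation_of_constants]).  It follows that
    [X = xi + tau * eta] and [Y = eta], with [eta = Xhat2 + V] and
    [xi = Xhat1 - Xhat2] known at time [s].  Since [tau] is independent of the
    past, conditioning replaces [tau] and [tau^2] by their means 1/2 and 1/3
    ([cond_exp_mixture]), and these numbers are the entries of [calT]: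
    [F = calT (Xhat + calB V)] ([F_response]).  For [u = uhat] the response
    vanishes, so [F = calT Xhat].

    The feedback gains agree because [Itilde] is the transpose of [calT calB].
    The matrix [M0] is off-diagonal and [M1] is symmetric, and from them one
    builds a matrix [reduced_value] for which [K calT = calB^T reduced_value].
    It solves the Riccati equation and the final condition of [P], hence it is
    [P]; similarly [p = calT^T M2] ([gain_identity]).  All these identifications
    are instances of one uniqueness principle for linear systems with a final
    condition ([backward_uniqueness]).

    Conversely, if [u] satisfies the feedback relation, then the formula for [F]
    and the identity of the gains turn it into
    [u - uhat = - calB^T P calB V].  As [V] is an integral of [u - uhat], the
    expected deviation of [u] from [uhat] is bounded by a multiple of its own
    integral, and vanishes by Gronwall's argument ([deviation_zero]). *)

Set Implicit Arguments.
Unset Strict Implicit.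
Unset Printing Implicit Defensive.

Import Order.TTheory GRing.Theory Num.Theory.
Local Open Scope classical_set_scope.
Local Open Scope ring_scope.

(** * Backward uniqueness for ordinary differential systems *)

Lemma within_continuous_sum (R : realType) (I : Type) (r : seq I) (A : set R)
    (f : I -> R -> R) :
  (forall i, {within A, continuous (f i)}) ->
  {within A, continuous (fun s => \sum_(i <- r) f i s)}.
Proof.
move=> fc; elim: r => [|i r IH].
  rewrite (_ : (fun _ => _) = cst 0); last by apply/funext => s; rewrite big_nil.
  by move=> s; exact: cvg_cst.
rewrite (_ : (fun _ => _) = (f i + (fun s => \sum_(j <- r) f j s))).
  exact: within_continuousD.
by apply/funext => s; rewrite big_cons.
Qed.

Lemma is_derive_big_sum (R : realType) (I : Type) (r : seq I)
    (f : I -> R -> R) (df : I -> R) (s : R) :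
  (forall i, is_derive s 1 (f i) (df i)) ->
  is_derive s 1 (fun x => \sum_(i <- r) f i x) (\sum_(i <- r) df i).
Proof.
move=> fd; elim: r => [|i r IH].
  rewrite big_nil (_ : (fun _ => _) = cst 0).
    exact: is_derive_cst.
  by apply/funext => x; rewrite big_nil.
rewrite big_cons (_ : (fun _ => _) = (f i + (fun x => \sum_(j <- r) f j x))).
  exact: is_deriveD.
by apply/funext => x; rewrite big_cons.
Qed.

Lemma within_continuous_bounded (R : realType) (a b : R) (f : R -> R) :
  {within `[a, b], continuous f} ->
  exists2 C, 0 <= C & forall s, a <= s <= b -> `|f s| <= C.
Proof.
move=> fc; have [ab|ba] := leP a b; last first.
  exists 0 => // s /andP[as_ sb]; have := le_trans as_ sb.
  by rewrite leNgt ba.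
have [c _ hc] := EVT_max ab fc; have [e _ he] := EVT_min ab fc.
exists (`|f c| + `|f e|); first by rewrite addr_ge0.
move=> s asb; have sI : s \in `[a, b] by rewrite in_itv.
have {}hc := hc _ sI; have {}he := he _ sI.
rewrite ler_norml; apply/andP; split.
  have := ler_norm (- f e); rewrite normrN => h.
  by have := normr_ge0 (f c); lra.
by have := ler_norm (f c); have := normr_ge0 (f e); lra.
Qed.

(** The energy $\sum_i f_i^2$, weighted by an exponential, is nondecreasing,
    so it cannot exceed its vanishing final value. *)
Lemma backward_uniqueness (R : realType) (I : finType) (t T C : R)
    (f : I -> R -> R) :
  0 <= C ->
  (forall i, {within `[t, T], continuous (f i)}) ->
  (forall i s, t < s < T -> derivable (f i) s 1) ->
  (forall i s, t < s < T -> `|derive1 (f i) s| <= C * \sum_j `|f j s|) ->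
  (forall i, f i T = 0) ->
  forall i s, t <= s <= T -> f i s = 0.
Proof.
move=> C0 fc fd fb fT i s tsT.
pose e x := \sum_j f j x ^+ 2.
pose K := C * 2 * #|I|%:R.
pose phi x := expR (K * x) * e x.
have e0 x : 0 <= e x by apply: sumr_ge0 => j _; exact: sqr_ge0.
have phid x : t < x < T ->
    is_derive x 1 phi (expR (K * x) * (K * e x
       + \sum_j 2 * f j x * derive1 (f j) x)).
  move=> xtT.
  have h1 : is_derive x 1 (fun y => expR (K * y)) (expR (K * x) * K).
    have hK : is_derive x 1 (fun y => K * y) K.
      have := is_deriveZ K (is_derive_id x 1).
      by rewrite -[K *: 1]/(K * 1) mulr1.
    exact: (@is_derive1_comp _ expR (fun y => K * y) x _ _ (is_derive_expR _) hK).
  have h2 : is_derive x 1 e (\sum_j 2 * f j x * derive1 (f j) x).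
    apply: is_derive_big_sum => j.
    have hj : is_derive x 1 (f j) (derive1 (f j) x).
      by rewrite derive1E; apply: derivableP; exact: fd.
    have := is_deriveM hj hj.
    rewrite (_ : f j * f j = fun y => f j y ^+ 2); last first.
      by apply/funext => y; rewrite /GRing.mul/= -expr2.
    by move=> h; apply: (is_derive_eq h); rewrite -![_ *: _]/(_ * _); ring.
  have h := is_deriveM h1 h2; apply: (is_derive_eq h).
  rewrite -![_ *: _]/(_ * _); ring.
have phi'0 x : t < x < T -> 0 <= derive1 phi x.
  move=> xtT; rewrite derive1E; have h := phid _ xtT; rewrite derive_val.
  rewrite mulr_ge0 ?expR_ge0//.
  suff : - (\sum_j 2 * f j x * derive1 (f j) x) <= K * e x by lra.
  apply: le_trans (_ : \sum_j \sum_k C * (f j x ^+ 2 + f k x ^+ 2) <= _).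
    rewrite -sumrN; apply: ler_sum => j _.
    apply: (le_trans (ler_norm _)); rewrite normrN !normrM normr_nat.
    apply: le_trans (ler_wpM2l _ (fb j _ xtT)) _; first by rewrite mulr_ge0.
    rewrite mulrCA -mulr_sumr ler_wpM2l// mulr_sumr; apply: ler_sum => k _.
    rewrite -(real_normK (num_real (f j x))) -(real_normK (num_real (f k x))).
    by have := sqr_ge0 (`|f j x| - `|f k x|); rewrite sqrrB; lra.
  under eq_bigr do rewrite -mulr_sumr big_split/= sumr_const.
  rewrite -mulr_sumr big_split/= sumrMnl sumr_const -/(e x) /K.
  rewrite -[e x *+ _]mulr_natr le_eqVlt; apply/orP; left; apply/eqP; ring.
have phic : {within `[t, T], continuous phi}.
  move=> x; apply: cvgM; last first.
    have : {within `[t, T], continuous e}; last exact.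
    by apply: within_continuous_sum => j y; apply: cvgM; exact: fc.
  have : {within `[t, T], continuous (fun y => expR (K * y))}; last exact.
  apply: continuous_subspaceT => y.
  apply: continuous_comp; last exact: continuous_expR.
  by apply: cvgM; [exact: cvg_cst|exact: cvg_id].
have [st sT] := andP tsT.
have sI : s \in `[t, T] by rewrite in_itv.
have TI : T \in `[t, T] by rewrite in_itv/= lexx (le_trans st).
have h : phi s <= phi T.
  have dphi x : x \in `]t, T[ -> derivable phi x 1.
    by rewrite in_itv/= => /phid[].
  have dphi0 x : x \in `]t, T[ -> 0 <= derive1 phi x.
    by rewrite in_itv/= => /phi'0.
  exact: (@ger0_derive1_le_cc _ phi t T dphi dphi0 phic s T sI TI sT).
have phiT : phi T = 0.
  by rewrite /phi /e big1 ?mulr0// => j _; rewrite fT expr0n.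
have : e s <= 0.
  by move: h; rewrite phiT /phi pmulr_rle0// expR_gt0.
move=> es; have {es} /eqP : e s = 0 by apply/eqP; rewrite eq_le es e0.
rewrite psumr_eq0; last by move=> j _; exact: sqr_ge0.
by move/allP => /(_ i (mem_index_enum _)); rewrite sqrf_eq0 => /eqP.
Qed.

(** A derivative of a matrix-valued function commutes with every constant
    linear map, since the entries of the image are fixed linear combinations
    of the entries. *)
Lemma regular_on_linear (R : realType) (m n p q : nat) (t T : R)
    (L : 'M[R]_(m, n) -> 'M[R]_(p, q)) (M : R -> 'M[R]_(m, n)) :
  linear L -> regular_on t T M ->
  regular_on t T (L \o M) /\
  forall s, t < s < T -> mxderiv (L \o M) s = L (mxderiv M s).
Proof.
move=> linL regM.
pose LL : {linear _ -> _} := HB.pack L (GRing.isLinear.Build _ _ _ _ L linL).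
have LZ c A : L (c *: A) = c *: L A by exact: (linearZ_LR LL).
have LE A k l : L A k l = \sum_ij A ij.1 ij.2 * L (delta_mx ij.1 ij.2) k l.
  have LS (f : 'I_m * 'I_n -> 'M[R]_(m, n)) : L (\sum_ij f ij) = \sum_ij L (f ij).
    exact: (linear_sum LL).
  rewrite {1}(matrix_sum_delta A) pair_big/= LS.
  by rewrite summxE; apply: eq_bigr => -[i j] _; rewrite LZ mxE.
have fE k l : (fun s => (L \o M) s k l)
    = (fun s => \sum_ij L (delta_mx ij.1 ij.2) k l * M s ij.1 ij.2).
  by apply/funext => s /=; rewrite LE; apply: eq_bigr => ij _; rewrite mulrC.
have dE k l s : t < s < T -> is_derive s 1 (fun s => (L \o M) s k l)
    (L (mxderiv M s) k l).
  move=> stT; rewrite fE LE.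
  have -> : \sum_ij mxderiv M s ij.1 ij.2 * L (delta_mx ij.1 ij.2) k l
      = \sum_ij L (delta_mx ij.1 ij.2) k l *: derive1 (fun r => M r ij.1 ij.2) s.
    by apply: eq_bigr => ij _; rewrite mxE mulrC.
  apply: is_derive_big_sum => ij.
  have [_ /(_ s stT) dM] := regM ij.1 ij.2.
  have : is_derive s 1 (fun r => M r ij.1 ij.2) (derive1 (fun r => M r ij.1 ij.2) s).
    by rewrite derive1E; exact: derivableP.
  exact: is_deriveZ.
split; last first.
  move=> s stT; apply/matrixP => k l.
  by rewrite mxE derive1E; have h := dE k l _ stT; rewrite derive_val.
move=> k l; split; last by move=> s stT; have [] := dE k l _ stT.
rewrite fE; apply: within_continuous_sum => ij x.
by apply: cvgM; [exact: cvg_cst|apply: (regM ij.1 ij.2).1].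
Qed.

Lemma regular_onD (R : realType) (m n : nat) (t T : R)
    (M M' : R -> 'M[R]_(m, n)) :
  regular_on t T M -> regular_on t T M' ->
  regular_on t T (fun s => M s + M' s) /\
  forall s, t < s < T ->
    mxderiv (fun s => M s + M' s) s = mxderiv M s + mxderiv M' s.
Proof.
move=> rM rM'.
have E i j : (fun s => (M s + M' s) i j)
    = (fun s => M s i j) + (fun s => M' s i j).
  by apply/funext => s; rewrite mxE.
split=> [i j|s stT].
  rewrite E; split; first by apply: within_continuousD; [case: (rM i j)|case: (rM' i j)].
  move=> s stT; apply: derivableD; [exact: (rM i j).2|exact: (rM' i j).2].
apply/matrixP => i j; rewrite !mxE E !derive1E deriveD//.
  exact: (rM i j).2.
exact: (rM' i j).2.
Qed.

Lemma matrix_ode_uniqueness (R : realType) (m n : nat) (t T C : R)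
    (B : R -> 'M[R]_m) (B' : R -> 'M[R]_n) (D : R -> 'M[R]_(m, n)) :
  0 <= C ->
  (forall s, t < s < T -> forall i j, `|B s i j| <= C) ->
  (forall s, t < s < T -> forall i j, `|B' s i j| <= C) ->
  regular_on t T D ->
  (forall s, t < s < T -> mxderiv D s = B s *m D s + D s *m B' s) ->
  D T = 0 ->
  forall s, t <= s <= T -> D s = 0.
Proof.
move=> C0 BC B'C rD oD DT s stT; apply/matrixP => i j.
rewrite [RHS]mxE.
apply: (@backward_uniqueness R ('I_m * 'I_n)%type t T (C + C)
  (fun ij r => D r ij.1 ij.2) _ _ _ _ _ (i, j)) => //.
- by rewrite addr_ge0.
- by move=> ij; case: (rD ij.1 ij.2).
- by move=> ij; case: (rD ij.1 ij.2).
- move=> [k l] r rtT /=.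
  have -> : derive1 (fun r => D r k l) r = mxderiv D r k l by rewrite mxE.
  rewrite oD// mxE mulrDl; apply: (le_trans (ler_normD _ _)); apply: lerD.
    rewrite mxE; apply: (le_trans (ler_norm_sum _ _ _)).
    apply: (@le_trans _ _ (\sum_a C * `|D r a l|)).
      by apply: ler_sum => a _; rewrite normrM ler_wpM2r// BC.
    rewrite -mulr_sumr ler_wpM2l//.
    rewrite -(pair_bigA _ (fun a b => `|D r a b|))/=; apply: ler_sum => a _.
    by rewrite (bigD1 l)//= lerDl sumr_ge0.
  rewrite mxE; apply: (le_trans (ler_norm_sum _ _ _)).
  apply: (@le_trans _ _ (\sum_b C * `|D r k b|)).
    by apply: ler_sum => b _; rewrite normrM mulrC ler_wpM2r// B'C.
  rewrite -mulr_sumr ler_wpM2l//.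
  rewrite -(pair_bigA _ (fun a b => `|D r a b|))/= [leRHS](bigD1 k)//= lerDl.
  by do 2 (apply: sumr_ge0 => ? _).
- by move=> ij /=; rewrite DT mxE.
Qed.

Lemma regular_on_bounded (R : realType) (m n : nat) (t T : R)
    (M : R -> 'M[R]_(m, n)) :
  regular_on t T M ->
  exists2 C, 0 <= C & forall s, t <= s <= T -> forall i j, `|M s i j| <= C.
Proof.
move=> rM.
have /choice[c hc] : forall ij : 'I_m * 'I_n, exists C,
    0 <= C /\ forall s, t <= s <= T -> `|M s ij.1 ij.2| <= C.
  move=> ij; have [C C0 hC] := within_continuous_bounded (rM ij.1 ij.2).1.
  by exists C.
exists (\sum_ij c ij) => [|s stT i j].
  by apply: sumr_ge0 => ij _; case: (hc ij).
apply: (le_trans ((hc (i, j)).2 _ stT)).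
by rewrite (bigD1 (i, j))//= lerDl sumr_ge0// => ij _; case: (hc ij).
Qed.

(** * Reduction of the feedback gain *)

Section Reduction.
Context {R : realType} {N : nat}.
Implicit Types (a : 'I_N -> R -> R) (M : 'M[R]_(N + N)).

Lemma AN_tr a s : (AN a s)^T = AN a s.
Proof. exact: tr_diag_mx. Qed.

Lemma calA_tr a s : (calA a s)^T = calA a s.
Proof. by rewrite /calA tr_block_mx AN_tr !trmx0. Qed.

Lemma calA_bounded a (t T : R) :
  (forall i, {within `[t, T], continuous (a i)}) ->
  exists2 C, 0 <= C & forall s, t <= s <= T -> forall i j, `|calA a s i j| <= C.
Proof.
move=> a_cont.
have /choice[c hc] : forall i, exists C,
    0 <= C /\ forall s, t <= s <= T -> `|a i s| <= C.
  by move=> i; have [C C0 hC] := within_continuous_bounded (a_cont i); exists C.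
have C0 : 0 <= \sum_i c i by apply: sumr_ge0 => i _; case: (hc i).
exists (\sum_i c i) => // s stT.
have h i j : `|AN a s i j| <= \sum_i c i.
  rewrite !mxE; case: eqP => _; rewrite ?mulr0n ?normr0// mulr1n.
  apply: (le_trans ((hc i).2 _ stT)).
  by rewrite (bigD1 i)//= lerDl sumr_ge0// => k _; case: (hc k).
move=> i j; case: (split_ordP i) => k ->; case: (split_ordP j) => l ->;
  by rewrite ?block_mxEul ?block_mxEur ?block_mxEdl ?block_mxEdr// mxE normr0.
Qed.

(** The defect vanishes exactly when [M] has the form of [Qmx] and [Qbar], and
    [reduced_part] maps [Qmx] and [Qbar] to [calQ] and [calG].  Both linear maps
    commute with the Lyapunov operator, because [calA] is block diagonal with
    equal symmetric blocks. *)
Definition offdiag_defect M : 'M[R]_(N + N) :=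
  M - block_mx 0 (dlsubmx M)^T (dlsubmx M) 0.

Definition reduced_part M : 'M[R]_(N + N) :=
  block_mx 0 (dlsubmx M)^T (dlsubmx M)
    (- ((1 / 2) *: (dlsubmx M + (dlsubmx M)^T))).

Lemma offdiag_defect_linear : linear offdiag_defect.
Proof.
move=> c A B; rewrite /offdiag_defect -[A]submxK -[B]submxK.
rewrite scale_block_mx !add_block_mx !block_mxKdl linearP/=.
rewrite !opp_block_mx !add_block_mx scale_block_mx add_block_mx.
congr block_mx; rewrite ?oppr0 ?addr0 ?subrr ?scaler0 ?addr0//.
by rewrite scalerBr opprD addrACA.
Qed.

Lemma reduced_part_linear : linear reduced_part.
Proof.
move=> c A B; rewrite /reduced_part -[A]submxK -[B]submxK.
rewrite scale_block_mx !add_block_mx !block_mxKdl linearP/=.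
rewrite !scale_block_mx !add_block_mx.
congr block_mx; rewrite ?scaler0 ?addr0//.
by apply/matrixP => i j; rewrite !mxE; ring.
Qed.

Lemma offdiag_defect_lyapunov a s M :
  offdiag_defect ((calA a s)^T *m M + M *m calA a s)
  = (calA a s)^T *m offdiag_defect M + offdiag_defect M *m calA a s.
Proof.
rewrite calA_tr /offdiag_defect -[M]submxK /calA.
rewrite !mulmx_block !add_block_mx !opp_block_mx !block_mxKdl.
rewrite !add_block_mx !mulmx_block !add_block_mx.
rewrite !(mul0mx, mulmx0, addr0, add0r, oppr0, subrr).
congr block_mx.
rewrite linearD/= !trmx_mul AN_tr mulmxBr mulmxBl.
by rewrite [X in _ - X]addrC opprD addrACA.
Qed.

Lemma reduced_part_lyapunov a s M :
  reduced_part ((calA a s)^T *m M + M *m calA a s)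
  = (calA a s)^T *m reduced_part M + reduced_part M *m calA a s.
Proof.
rewrite calA_tr /reduced_part -[M]submxK /calA.
rewrite !mulmx_block !add_block_mx !block_mxKdl.
rewrite !(mul0mx, mulmx0, addr0, add0r, oppr0, subrr).
congr block_mx; rewrite [(_ + _)^T]linearD/= !trmx_mul AN_tr; first by rewrite addrC.
rewrite mulmxN mulNmx -scalemxAr -scalemxAl -opprD -scalerDr.
congr (- (_ *: _)); rewrite mulmxDl mulmxDr.
by rewrite [X in _ + X = _]addrC addrACA.
Qed.

Lemma Gamma_tr (gamma : 'I_N -> R) : (Gamma gamma)^T = Gamma gamma.
Proof. exact: tr_diag_mx. Qed.

Lemma offdiag_defect_Qmx (q : 'I_N -> 'I_N -> R) : offdiag_defect (Qmx q) = 0.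
Proof. by rewrite /offdiag_defect /Qmx block_mxKdl subrr. Qed.

Lemma offdiag_defect_Qbar (gamma : 'I_N -> R) : offdiag_defect (Qbar gamma) = 0.
Proof. by rewrite /offdiag_defect /Qbar block_mxKdl Gamma_tr subrr. Qed.

Lemma reduced_part_Qmx (q : 'I_N -> 'I_N -> R) : reduced_part (Qmx q) = calQ q.
Proof. by rewrite /reduced_part /Qmx block_mxKdl. Qed.

Lemma half_double (V : lmodType R) (v : V) : (1 / 2) *: (v + v) = v.
Proof.
have -> : v + v = 2 *: v by rewrite scaler_nat mulr2n.
by rewrite scalerA mul1r mulVf ?scale1r// pnatr_eq0.
Qed.

Lemma reduced_part_Qbar (gamma : 'I_N -> R) :
  reduced_part (Qbar gamma) = calG gamma.
Proof.
by rewrite /reduced_part /Qbar block_mxKdl Gamma_tr half_double.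
Qed.

Lemma bbA_calT a s : bbA a s *m calT = calT *m calA a s :> 'M[R]_(_, N + N).
Proof.
rewrite /bbA /calT /calA !(mul_block_col, mul_col_mx, mulmx_block).
by rewrite !(mul_mx_row, mul0mx, mulmx0, add_row_mx, addr0, add0r, mulmx1, mul1mx,
  mul_mx_scalar, mul_scalar_mx).
Qed.

(** The blocks of [Itilde] carry the moments 1/2, 1, 1/3, 1/2 of the uniform law,
    and so do the sums of the two columns of [calT]. *)
Lemma Itilde_calT : Itilde = calB^T *m calT^T :> 'M[R]_(N, _).
Proof.
rewrite -trmx_mul /calT /calB.
rewrite !(mul_col_mx, mul_row_col, mulmx1, mul1mx, mul0mx, add0r, mulmx0).
rewrite -!raddfD/= !tr_col_mx !tr_scalar_mx /Itilde.
by congr (row_mx (row_mx _%:M _%:M) (row_mx _%:M _%:M)); lra.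
Qed.

(** The summand of the gain in [M1] is a multiple of [calB^T] by [Itilde_calT];
    [reduced_part] is chosen so that the summand in [M0] becomes one too. *)
Lemma gain_calT M (M1 : 'M[R]_((N + N) + (N + N))) :
  offdiag_defect M = 0 ->
  Kmx M M1 *m calT = calB^T *m (calT^T *m M1 *m calT + reduced_part M).
Proof.
move=> /subr0_eq M_off; rewrite /Kmx mulmxDl addrC mulmxDr; congr (_ + _).
  by rewrite Itilde_calT !mulmxA.
rewrite [in LHS]M_off /reduced_part; set m := dlsubmx M.
rewrite /calT /calB tr_col_mx trmx1.
rewrite !(mul_row_block, mul_row_col, mul0mx, mulmx0, mul1mx, mulmx1, addr0, add0r,
  mul_mx_row, add_row_mx, mul_mx_scalar).
clearbody m; congr row_mx; apply/matrixP => i j; rewrite !mxE; lra.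
Qed.

End Reduction.
Lemma linear_mulmx (R : comPzRingType) (m n k l : nat) (A : 'M[R]_(k, m))
    (B : 'M[R]_(n, l)) :
  linear (fun M : 'M[R]_(m, n) => A *m M *m B).
Proof. by move=> c X Y /=; rewrite mulmxDr mulmxDl -scalemxAr -scalemxAl. Qed.

Section Gain.
Context {R : realType} {N : nat} (t T : R) (a sigma : 'I_N -> R -> R)
  (q : 'I_N -> 'I_N -> R) (gamma : 'I_N -> R) (d : 'cV[R]_N)
  (M0 : R -> 'M[R]_(N + N)) (M1 : R -> 'M[R]_((N + N) + (N + N)))
  (M2 : R -> 'cV[R]_((N + N) + (N + N))) (M3 : R -> R)
  (P : R -> 'M[R]_(N + N)) (p : R -> 'cV[R]_(N + N)).
Hypothesis a_cont : forall i, {within `[t, T], continuous (a i)}.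
Hypothesis M_solves : system_M t T a sigma q gamma d M0 M1 M2 M3.
Hypothesis Pp_solves : reduced_R t T a q gamma d P p.

Let oo_cc s : t < s < T -> t <= s <= T.
Proof. by case/andP => a1 a2; rewrite !ltW. Qed.

Lemma lyapunov_image (L : 'M[R]_(N + N) -> 'M[R]_(N + N)) :
  linear L ->
  (forall s M, L ((calA a s)^T *m M + M *m calA a s)
     = (calA a s)^T *m L M + L M *m calA a s) ->
  regular_on t T (L \o M0) /\
  forall s, t < s < T -> mxderiv (L \o M0) s
    = - ((calA a s)^T *m L (M0 s) + L (M0 s) *m calA a s + L (Qmx q)).
Proof.
move=> linL Llyap.
have [rD dD] := regular_on_linear linL (M0_regular M_solves).
split=> // s stT; rewrite dD// -Llyap.
pose LL : {linear _ -> _} := HB.pack L (GRing.isLinear.Build _ _ _ _ L linL).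
have LD A B : L (A + B) = L A + L B by exact: (raddfD LL).
have LN A : L (- A) = - L A by exact: (raddfN LL).
rewrite -LD -LN; congr L; apply/eqP; rewrite -addr_eq0 !addrA; apply/eqP.
exact: (M0_ode M_solves stT).
Qed.

Lemma offdiag_M0 s : t <= s <= T -> offdiag_defect (M0 s) = 0.
Proof.
have [C C0 hC] := calA_bounded a_cont.
have [rD dD] := lyapunov_image offdiag_defect_linear (offdiag_defect_lyapunov a).
have hN s' : t < s' < T -> forall i j, `|(- calA a s') i j| <= C.
  by move=> /oo_cc h i j; rewrite mxE normrN hC.
apply: (matrix_ode_uniqueness C0 hN hN rD) => [r rtT|]; last first.
  by rewrite /= (M0_final M_solves) offdiag_defect_Qbar.
by rewrite dD//= offdiag_defect_Qmx addr0 calA_tr mulNmx mulmxN opprD.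
Qed.

(** The antisymmetric part of [M1] solves a homogeneous Lyapunov equation with
    zero final value, since the quadratic term is symmetric. *)
Lemma M1_sym s : t <= s <= T -> (M1 s)^T = M1 s.
Proof.
move=> stT; apply/eqP; rewrite -subr_eq0; apply/eqP; move: s stT.
have [C C0 hC] := calA_bounded a_cont.
have linL : linear (fun M : 'M[R]_((N + N) + (N + N)) => M^T - M).
  by move=> c A B; rewrite linearP/= scalerBr opprD addrACA.
have [rD dD] := regular_on_linear linL (M1_regular M_solves).
have hN s : t < s < T -> forall i j, `|(- bbA a s) i j| <= C.
  move=> /oo_cc h i j; rewrite mxE normrN.
  case: (split_ordP i) => k ->; case: (split_ordP j) => l ->;
    by rewrite ?block_mxEul ?block_mxEur ?block_mxEdl ?block_mxEdr ?hC// mxE normr0.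
apply: (matrix_ode_uniqueness C0 hN hN rD) => [r rtT|]; last first.
  by rewrite /= (M1_final M_solves) trmx0 subrr.
have bbA_tr : (bbA a r)^T = bbA a r by rewrite /bbA tr_block_mx calA_tr !trmx0.
rewrite dD//=.
have -> : mxderiv M1 r = (Kmx (M0 r) (M1 r))^T *m Kmx (M0 r) (M1 r)
    - bbA a r *m M1 r - M1 r *m bbA a r.
  have /eqP := M1_ode M_solves rtT; rewrite bbA_tr subr_eq0 => /eqP <-.
  by rewrite addrAC !addrK.
rewrite !raddfB/= !trmx_mul bbA_tr trmxK mulmxN !mulNmx mulmxBl.
move: ((Kmx _ _)^T *m _) ((M1 r)^T *m _) (_ *m (M1 r)^T) (_ *m M1 r) (M1 r *m _).
by move=> X Y Z V V'; apply/matrixP => i j; rewrite !mxE; ring.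
Qed.

Definition reduced_value (s : R) : 'M[R]_(N + N) :=
  calT^T *m M1 s *m calT + reduced_part (M0 s).

Lemma reduced_value_tr s : t <= s <= T -> (reduced_value s)^T = reduced_value s.
Proof.
move=> stT; rewrite /reduced_value linearD/= !trmx_mul trmxK mulmxA M1_sym//.
rewrite /reduced_part tr_block_mx !trmx0 trmxK; congr (_ + block_mx _ _ _ _).
by rewrite linearN linearZ/= linearD/= trmxK [X in _ *: X]addrC.
Qed.

Lemma gain_reduced s : t <= s <= T ->
  Kmx (M0 s) (M1 s) *m calT = calB^T *m reduced_value s.
Proof. by move=> stT; rewrite gain_calT// offdiag_M0. Qed.

(** This is the Riccati equation of [P]: its quadratic term is the image of
    [K^T K] under [calT], by [gain_reduced] and the symmetry of
    [reduced_value]. *)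
Lemma reduced_value_ode :
  regular_on t T reduced_value /\ forall s, t < s < T ->
    mxderiv reduced_value s = reduced_value s *m calB *m calB^T *m reduced_value s
      - (calA a s *m reduced_value s + reduced_value s *m calA a s + calQ q).
Proof.
have [rL dL] := lyapunov_image reduced_part_linear (reduced_part_lyapunov a).
have [r1 d1] := regular_on_linear (linear_mulmx calT^T calT) (M1_regular M_solves).
have [rP dP] := regular_onD r1 rL.
split=> // s stT; rewrite dP// d1// dL// reduced_part_Qmx.
have bbA_tr : (bbA a s)^T = bbA a s by rewrite /bbA tr_block_mx calA_tr !trmx0.
have -> : mxderiv M1 s = (Kmx (M0 s) (M1 s))^T *m Kmx (M0 s) (M1 s)
    - bbA a s *m M1 s - M1 s *m bbA a s.
  have /eqP := M1_ode M_solves stT; rewrite bbA_tr subr_eq0 => /eqP <-.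
  by rewrite addrAC !addrK.
rewrite !mulmxBr !mulmxBl.
have -> : calT^T *m ((Kmx (M0 s) (M1 s))^T *m Kmx (M0 s) (M1 s)) *m calT
    = reduced_value s *m calB *m calB^T *m reduced_value s.
  rewrite mulmxA -trmx_mul -mulmxA gain_reduced ?oo_cc//.
  by rewrite trmx_mul trmxK reduced_value_tr ?oo_cc// !mulmxA.
have -> : calT^T *m (bbA a s *m M1 s) *m calT
    = calA a s *m (calT^T *m M1 s *m calT).
  rewrite mulmxA -[X in _ *m X *m _ *m _]bbA_tr -trmx_mul bbA_calT trmx_mul calA_tr.
  by rewrite !mulmxA.
have -> : calT^T *m (M1 s *m bbA a s) *m calT
    = (calT^T *m M1 s *m calT) *m calA a s.
  by rewrite -!mulmxA bbA_calT.
rewrite calA_tr [in RHS](_ : calA a s *m reduced_value s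
  = calA a s *m (calT^T *m M1 s *m calT) + calA a s *m reduced_part (M0 s));
  last by rewrite /reduced_value mulmxDr.
rewrite [in RHS](_ : reduced_value s *m calA a s
  = (calT^T *m M1 s *m calT) *m calA a s + reduced_part (M0 s) *m calA a s);
  last by rewrite /reduced_value mulmxDl.
move: (_ *m reduced_value s) (calA a s *m _) (calA a s *m _) => X Y Y'.
move: (_ *m calA a s) (_ *m calA a s) => Z Z'.
by apply/matrixP => i j; rewrite !mxE; ring.
Qed.

Let regular_onB m n (M M' : R -> 'M[R]_(m, n)) :
  regular_on t T M -> regular_on t T M' ->
  regular_on t T (fun s => M s - M' s) /\
  forall s, t < s < T ->
    mxderiv (fun s => M s - M' s) s = mxderiv M s - mxderiv M' s.
Proof.
move=> rM rM'; have linN : linear (fun M : 'M[R]_(m, n) => - M).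
  by move=> c A B; rewrite opprD scalerN.
have [rN dN] := regular_on_linear linN rM'; have [rD dD] := regular_onD rM rN.
by split=> // s stT; rewrite -dN//; exact: dD.
Qed.

(** Both sides solve the same Riccati equation, and the difference of two
    solutions [P] and [V] solves a linear one, because
    [P B P - V B V = P B (P - V) + (P - V) B V]. *)
Lemma P_reduced_value s : t <= s <= T -> P s = reduced_value s.
Proof.
move=> stT; apply/eqP; rewrite -subr_eq0; apply/eqP; move: s stT.
have [rV dV] := reduced_value_ode; have rP := P_regular Pp_solves.
have [rD dD] := regular_onB rP rV.
have [C C0 hC] := calA_bounded a_cont.
have [C1 C10 hC1] := regular_on_bounded
  (regular_on_linear (linear_mulmx 1%:M (calB *m calB^T)) rP).1.
have [C2 C20 hC2] := regular_on_bounded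
  (regular_on_linear (linear_mulmx (calB *m calB^T) 1%:M) rV).1.
pose B s := P s *m calB *m calB^T - calA a s.
pose B' s := calB *m calB^T *m reduced_value s - calA a s.
have E0 : 0 <= C1 + C2 + C by rewrite !addr_ge0.
have BC s : t < s < T -> forall i j, `|B s i j| <= C1 + C2 + C.
  move=> /oo_cc stT i j; rewrite mxE [X in _ + X]mxE.
  apply: (le_trans (ler_normB _ _)); apply: lerD; last exact: hC.
  have := hC1 _ stT i j; rewrite /= mul1mx mulmxA => h.
  by rewrite (le_trans h) ?lerDl.
have B'C s : t < s < T -> forall i j, `|B' s i j| <= C1 + C2 + C.
  move=> /oo_cc stT i j; rewrite mxE [X in _ + X]mxE.
  apply: (le_trans (ler_normB _ _)); apply: lerD; last exact: hC.
  have := hC2 _ stT i j; rewrite /= mulmx1 => h.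
  by rewrite (le_trans h) ?lerDr.
apply: (matrix_ode_uniqueness E0 BC B'C rD) => [s stT|]; last first.
  rewrite (P_final Pp_solves) /reduced_value (M1_final M_solves) (M0_final M_solves).
  by rewrite mulmx0 mul0mx add0r reduced_part_Qbar subrr.
rewrite dD// dV// /B /B'.
have -> : mxderiv P s = P s *m calB *m calB^T *m P s
    - (calA a s *m P s + P s *m calA a s + calQ q).
  have /eqP := P_ode Pp_solves stT; rewrite calA_tr subr_eq0 => /eqP <-.
  by apply/eqP; rewrite eq_sym subr_eq !addrA.
rewrite !mulmxBl !mulmxBr !mulmxA.
move: (_ *m calB^T *m _) (_ *m calB^T *m _) (_ *m calB^T *m _).
move: (calA a s *m P s) (calA a s *m _) (P s *m calA a s) (_ *m calA a s).
by move=> X Y Z V V' U U'; apply/matrixP => i j; rewrite !mxE; ring.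
Qed.

Lemma p_reduced s : t <= s <= T -> p s = calT^T *m M2 s.
Proof.
move=> stT; apply/eqP; rewrite -subr_eq0; apply/eqP; move: s stT.
have rP := P_regular Pp_solves.
have [r2 d2] := regular_on_linear (linear_mulmx calT^T 1%:M) (M2_regular M_solves).
have [rD dD] := regular_onB (p_regular Pp_solves) r2.
have [C C0 hC] := calA_bounded a_cont.
have [C1 C10 hC1] := regular_on_bounded
  (regular_on_linear (linear_mulmx 1%:M (calB *m calB^T)) rP).1.
pose B s := P s *m calB *m calB^T - calA a s.
have E0 : 0 <= C1 + C by rewrite addr_ge0.
have BC s : t < s < T -> forall i j, `|B s i j| <= C1 + C.
  move=> /oo_cc stT i j; rewrite mxE [X in _ + X]mxE.
  apply: (le_trans (ler_normB _ _)); apply: lerD; last exact: hC.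
  by have := hC1 _ stT i j; rewrite /= mul1mx mulmxA.
have B'C s : t < s < T -> forall i j, `|(0 : 'M[R]_1) i j| <= C1 + C.
  by move=> _ i j; rewrite mxE normr0.
suff main s : t <= s <= T -> p s - calT^T *m M2 s *m 1%:M = 0.
  by move=> s /main; rewrite mulmx1.
move: s; apply: (matrix_ode_uniqueness E0 BC B'C rD) => [s stT|]; last first.
  rewrite /= (p_final Pp_solves) (M2_final M_solves) mulmx1 /p0 /gfrak /calT.
  rewrite tr_col_mx mul_row_col mulmx0 addr0 tr_block_mx !trmx0 !tr_scalar_mx.
  by rewrite mulmxN mul_block_col !mulmx0 !mul0mx mul1mx !addr0 add0r subrr.
rewrite dD// d2// mulmx0 addr0 !mulmx1 /B.
have -> : mxderiv p s = P s *m calB *m calB^T *m p s - calA a s *m p s.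
  have /eqP := p_ode Pp_solves stT; rewrite calA_tr subr_eq0 => /eqP <-.
  by rewrite addrK.
have bbA_tr : (bbA a s)^T = bbA a s by rewrite /bbA tr_block_mx calA_tr !trmx0.
have -> : mxderiv M2 s = (Kmx (M0 s) (M1 s))^T *m (Itilde *m M2 s)
    - bbA a s *m M2 s.
  have /eqP := M2_ode M_solves stT; rewrite bbA_tr subr_eq0 => /eqP <-.
  by rewrite addrK.
have stT' := oo_cc stT.
rewrite mulmxBr [calT^T *m (_^T *m _)]mulmxA -trmx_mul gain_reduced//.
rewrite trmx_mul trmxK reduced_value_tr// -P_reduced_value// Itilde_calT.
have -> : calT^T *m (bbA a s *m M2 s) = calA a s *m (calT^T *m M2 s).
  by rewrite mulmxA -[X in _ *m X *m _]bbA_tr -trmx_mul bbA_calT trmx_mul calA_tr mulmxA.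
rewrite mulmxBl !mulmxBr !mulmxA !mulmx1.
move: (_ *m p s) (_ *m p s) (_ *m M2 s) (_ *m M2 s) => X Y Z V.
by apply/matrixP => i j; rewrite !mxE; ring.
Qed.

(** Through [calT] the gains of the McKean--Vlasov formulation become those of
    the reduced problem. *)
Lemma gain_identity s : t <= s <= T ->
  Kmx (M0 s) (M1 s) *m calT = calB^T *m P s /\ Itilde *m M2 s = calB^T *m p s.
Proof.
move=> stT; rewrite gain_reduced// P_reduced_value// p_reduced// mulmxA.
by rewrite Itilde_calT.
Qed.

End Gain.
(** * Uniqueness of the Ito integral of a deterministic integrand *)

(** Layer-cake formula for [h \o X] and again for [h], with the two
    integrations exchanged in between. *)
Lemma ge0_expectation_density (R : realType) (d : measure_display)
    (Omega : measurableType d) (P : probability Omega R) (X : {RV P >-> R})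
    (g h : R -> R) :
  measurable_fun setT g -> (forall x, 0 <= g x) ->
  measurable_fun setT h -> (forall x, 0 <= h x) ->
  (forall B, measurable B ->
     P (X @^-1` B) = \int[lebesgue_measure]_(x in B) (g x)%:E)%E ->
  (\int[P]_w (h (X w))%:E = \int[lebesgue_measure]_x (h x * g x)%:E)%E.
Proof.
move=> mg g0 mh h0 PX.
have mhX : measurable_fun setT (h \o X) by exact: measurableT_comp.
pose Y : {RV P >-> R} := HB.pack (h \o X) (isMeasurableFun.Build _ _ _ _ _ mhX).
pose f (z : R * R) := if (0 <= z.1) && (z.1 < h z.2) then g z.2 else 0.
have f0 z : 0 <= f z by rewrite /f; case: ifP.
have mf : measurable_fun setT f.
  apply: measurable_fun_if => //.
  - apply: measurable_and.
      by apply: measurable_fun_ler; [exact: measurable_cst|exact: measurable_fst].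
    apply: measurable_fun_ltr; first exact: measurable_fst.
    by apply: measurableT_comp => //; exact: measurable_snd.
  - by apply: measurable_funTS; apply: measurableT_comp => //; exact: measurable_snd.
have -> : (\int[P]_w (h (X w))%:E = 'E_P[Y])%E by rewrite expectation_def.
rewrite ge0_expectation_ccdf; last by move=> w; exact: h0.
transitivity (\int[lebesgue_measure]_r \int[lebesgue_measure]_x (f (r, x))%:E)%E.
  rewrite integral_mkcond; apply: eq_integral => r _.
  rewrite patchE; case: ifPn => r0.
    have -> : ccdf Y r = P (X @^-1` [set x | r < h x]).
      rewrite /ccdf /distribution /pushforward; congr (P _).
      by apply/seteqP; split => w /=; rewrite in_itv/= andbT.
    rewrite PX; last first.
      rewrite -[X in measurable X]setTI.
      have := measurable_fun_ltr (measurable_cst r) mh.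
      by move=> /(_ measurableT [set true]) => H; apply: H.
    rewrite integral_mkcond; apply: eq_integral => x _.
    rewrite patchE /f/=; move: r0; rewrite inE/= in_itv/= andbT => -> /=.
    by case: ifPn; rewrite ?inE ?notin_setE/= => rx; [rewrite rx|move/negP/negbTE: rx => ->].
  rewrite integral0_eq// => x _; rewrite /f/=.
  by move: r0; rewrite notin_setE/= in_itv/= andbT => /negP/negbTE ->.
have mf' : measurable_fun setT (EFin \o f) by exact/measurable_EFinP.
have f0' z : (0 <= (EFin \o f) z)%E by rewrite lee_fin.
rewrite (fubini_tonelli (m1:=lebesgue_measure) (m2:=lebesgue_measure) (EFin \o f) mf' f0')/=.
apply: eq_integral => x _.
transitivity (\int[lebesgue_measure]_(r in `[0%R, h x[) (g x)%:E)%E.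
  rewrite [RHS]integral_mkcond; apply: eq_integral => r _.
  by rewrite patchE /f/= mem_setE in_itv/=; case: ifP.
rewrite integral_cst//= lebesgue_measure_itv/= lte_fin.
case: ltP => hx; first by rewrite oppr0 adde0 -EFinM mulrC.
have -> : h x = 0 by apply/eqP; rewrite eq_le hx h0.
by rewrite mule0 mul0r.
Qed.

(** The moment scales with the square of the standard deviation; this
    proportionality alone makes step integrals isometric up to a constant. *)
Lemma normal_second_moment (R : realType) :
  exists2 kappa : R, 0 <= kappa &
    forall s : R, 0 < s ->
      (\int[lebesgue_measure]_x (x ^+ 2 * normal_pdf 0 s x)%:E
       = (kappa * s ^+ 2)%:E)%E.
Proof.
set k := (\int[lebesgue_measure]_x (x ^+ 2 * normal_pdf 0 1 x)%:E)%E : \bar R.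
have k0 : (0 <= k)%E.
  by apply: integral_ge0 => x _; rewrite lee_fin mulr_ge0 ?sqr_ge0 ?normal_pdf_ge0.
have m2 s : measurable_fun setT (fun x : R => x ^+ 2 * normal_pdf 0 s x).
  by apply: measurable_funM; [exact: measurable_funX|exact: measurable_normal_pdf].
have s20 : Num.sqrt 2 != 0 :> R by rewrite gt_eqF// sqrtr_gt0.
have kfin : k \is a fin_num.
  rewrite ge0_fin_numE//.
  pose c : R := 4 * normal_peak 1 / normal_peak (Num.sqrt 2).
  have c0 : 0 <= c by rewrite /c !mulr_ge0 ?invr_ge0 ?normal_peak_ge0.
  apply: (@le_lt_trans _ _ (\int[lebesgue_measure]_x
     (c * normal_pdf 0 (Num.sqrt 2) x)%:E)%E).
    apply: ge0_le_integral => //=.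
    - by move=> x _; rewrite lee_fin mulr_ge0 ?sqr_ge0 ?normal_pdf_ge0.
    - by apply/measurable_EFinP; exact: m2.
    - apply/measurable_EFinP; apply: measurable_funM => //.
      exact: measurable_normal_pdf.
    - move=> x _; rewrite lee_fin !normal_pdfE ?oner_neq0//=.
      (* one factor of the Gaussian absorbs the square *)
      set p1 := normal_peak 1; set p2 := normal_peak (Num.sqrt 2).
      have p20 : p2 != 0 by rewrite gt_eqF ?normal_peak_gt0.
      have -> : c * (p2 * normal_fun 0 (Num.sqrt 2) x)
          = p1 * (4 * normal_fun 0 (Num.sqrt 2) x) by rewrite /c -/p1 -/p2; field.
      rewrite mulrCA ler_wpM2l ?normal_peak_ge0// /normal_fun subr0 sqr_sqrtr//.
      rewrite expr1n.
      have -> : - x ^+ 2 / (1 *+ 2) = - x ^+ 2 / (2 *+ 2) + - x ^+ 2 / (2 *+ 2) :> R.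
        by field.
      rewrite expRD mulrA ler_wpM2r ?expR_ge0//.
      have := expR_ge1Dx (x ^+ 2 / 4); rewrite mulNr expRN.
      have -> : 2 *+ 2 = 4 :> R by lra.
      by move=> h; rewrite ler_pdivrMr ?expR_gt0//; lra.
  under eq_integral do rewrite EFinM.
  rewrite integralZl//; last exact: integrable_normal_pdf.
  by rewrite integral_normal_pdf mule1 ltry.
exists (fine k); first exact: fine_ge0.
move=> s s0.
pose F (x : R) := s * x.
have dF (x : R) : is_derive x 1 F s.
  have := is_deriveZ s (is_derive_id x 1).
  by rewrite -[s *: 1]/(s * 1) mulr1.
have F'E : derive1 F = cst s.
  by apply/funext => x; rewrite derive1E; have h := dF x; rewrite derive_val.
rewrite (@increasing_ge0_integration_by_substitutionT R F
  (fun x => x ^+ 2 * normal_pdf 0 s x)).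
- rewrite EFinM fineK// muleC -ge0_integralZl//.
  + apply: eq_integral => x _; rewrite F'E /= -EFinM; congr EFin.
    rewrite -[LHS]/((s * x) ^+ 2 * normal_pdf 0 s (s * x) * s).
    rewrite !normal_pdfE ?oner_neq0 ?gt_eqF//= /normal_fun !subr0 /normal_peak.
    rewrite !expr1n mul1r -mulrnAr sqrtrM ?sqr_ge0// sqrtr_sqr gtr0_norm//.
    rewrite exprMn.
    have -> : - (s ^+ 2 * x ^+ 2) / (s ^+ 2 *+ 2) = - x ^+ 2 / 2 :> R.
      by field; rewrite gt_eqF.
    by field; rewrite !gt_eqF// sqrtr_gt0 mulrn_wgt0// pi_gt0.
  + by apply/measurable_EFinP; exact: m2.
  + by move=> x _; rewrite lee_fin mulr_ge0 ?sqr_ge0 ?normal_pdf_ge0.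
  + by rewrite lee_fin sqr_ge0.
- by move=> x y xy; rewrite /F ltr_pM2l.
- by rewrite F'E => x; exact: cvg_cst.
- by rewrite F'E; exact: is_cvg_cst.
- by rewrite F'E; exact: is_cvg_cst.
- by move=> x; have [] := dF x.
- by apply/gt0_cvgMrNy => //; exact: cvg_id.
- by apply/gt0_cvgMry => //; exact: cvg_id.
- move=> x; apply: cvgM; first exact: sqr_continuous.
  by apply: continuous_normal_pdf; rewrite gt_eqF.
- by move=> x; rewrite mulr_ge0 ?sqr_ge0 ?normal_pdf_ge0.
Qed.

Definition has_integral (R : realType) (d : measure_display)
    (Omega : measurableType d) (mu : {measure set Omega -> \bar R})
    (D : set Omega) (f : Omega -> R) (r : R) : Prop :=
  mu.-integrable D (EFin \o f) /\ (\int[mu]_(w in D) (f w)%:E = r%:E)%E.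

Section HasIntegral.
Context (R : realType) (d : measure_display) (Omega : measurableType d)
  (mu : {measure set Omega -> \bar R}) (D : set Omega) (mD : measurable D).
Implicit Types (f g : Omega -> R) (r : R).

Lemma has_integralD f g r r' :
  has_integral mu D f r -> has_integral mu D g r' ->
  has_integral mu D (fun w => f w + g w) (r + r').
Proof.
move=> [fi fr] [gi gr]; split.
  have -> : EFin \o (fun w => f w + g w) = (EFin \o f) \+ (EFin \o g) by [].
  exact: integrableD.
transitivity (\int[mu]_(w in D) ((f w)%:E + (g w)%:E))%E.
  by apply: eq_integral => w _; rewrite EFinD.
by rewrite integralD//= fr gr.
Qed.

Lemma has_integralZ f r c :
  has_integral mu D f r -> has_integral mu D (fun w => c * f w) (c * r).
Proof.
move=> [fi fr]; split.
  have -> : EFin \o (fun w => c * f w) = (fun w => c%:E * (EFin \o f) w)%E by [].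
  exact: integrableZl.
transitivity (\int[mu]_(w in D) (c%:E * (f w)%:E))%E.
  by apply: eq_integral => w _; rewrite EFinM.
by rewrite integralZl//= fr.
Qed.

Lemma has_integral_sum (I : eqType) (s : seq I) (f : I -> Omega -> R) (r : I -> R) :
  {in s, forall i, has_integral mu D (f i) (r i)} ->
  has_integral mu D (fun w => \sum_(i <- s) f i w) (\sum_(i <- s) r i).
Proof.
elim: s => [|i s IH] h.
  rewrite big_nil; split.
    rewrite (_ : EFin \o _ = cst 0%E); first exact: integrable0.
    by apply/funext => w /=; rewrite big_nil.
  by rewrite integral0_eq// => w _; rewrite big_nil.
rewrite big_cons.
have -> : (fun w => \sum_(j <- i :: s) f j w)
    = (fun w => f i w + \sum_(j <- s) f j w) by apply/funext => w; rewrite big_cons.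
apply: has_integralD; first by apply: h; rewrite mem_head.
by apply: IH => j js; apply: h; rewrite inE js orbT.
Qed.

(** Twice the covariance of two increments of a process whose increments have
    second moment equal to the length of the time step, by polarization. *)
Definition covar (a b a' b' : R) : R :=
  `|a - b'| + `|b - a'| - `|a - a'| - `|b - b'|.

(** The squared norm of the part of a step function before time [s], as a double
    sum over its steps. *)
Definition step_norm2 (f : seq (R * R * R)) (s : R) : R :=
  \sum_(e <- f) \sum_(e' <- f) e.1.1 * e'.1.1 * (1 / 2)
    * covar (Num.min e.1.2 s) (Num.min e.2 s) (Num.min e'.1.2 s) (Num.min e'.2 s).

(** The second moment of a step integral depends on the process only through
    the second moments of its increments.  It serves for Brownian motion and for
    the indicators of [r <= x] under Lebesgue measure, whose step integrals are
    the step functions themselves. *)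
Lemma step_int_second_moment (G : R -> Omega -> R) (t T kappa : R)
    (f : seq (R * R * R)) (s : R) :
  (forall x y, t <= x <= T -> t <= y <= T ->
     has_integral mu D (fun w => (G x w - G y w) ^+ 2) (kappa * `|x - y|)) ->
  (forall e, e \in f -> [/\ t <= e.1.2, e.1.2 <= e.2 & e.2 <= T]) ->
  t <= s <= T ->
  has_integral mu D (fun w => step_int G f s w ^+ 2) (kappa * step_norm2 f s).
Proof.
move=> hG hf /andP[ts sT].
pose H (e e' : R * R * R) w := e.1.1 * e'.1.1 * (1 / 2) *
  ((G (Num.min e.1.2 s) w - G (Num.min e'.2 s) w) ^+ 2
   + ((G (Num.min e.2 s) w - G (Num.min e'.1.2 s) w) ^+ 2
   + ((-1) * (G (Num.min e.1.2 s) w - G (Num.min e'.1.2 s) w) ^+ 2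
   + (-1) * (G (Num.min e.2 s) w - G (Num.min e'.2 s) w) ^+ 2))).
have -> : (fun w => step_int G f s w ^+ 2)
    = (fun w => \sum_(e <- f) \sum_(e' <- f) H e e' w).
  apply/funext => w; rewrite /step_int expr2 mulr_suml.
  apply: eq_bigr => e _; rewrite mulr_sumr; apply: eq_bigr => e' _.
  by rewrite /H; field.
have -> : kappa * step_norm2 f s = \sum_(e <- f) \sum_(e' <- f)
    e.1.1 * e'.1.1 * (1 / 2) *
    (kappa * `|Num.min e.1.2 s - Num.min e'.2 s|
     + (kappa * `|Num.min e.2 s - Num.min e'.1.2 s|
     + ((-1) * (kappa * `|Num.min e.1.2 s - Num.min e'.1.2 s|)
     + (-1) * (kappa * `|Num.min e.2 s - Num.min e'.2 s|)))).
  rewrite /step_norm2 mulr_sumr; apply: eq_bigr => e _.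
  rewrite mulr_sumr; apply: eq_bigr => e' _; rewrite /covar; ring.
have minP x : t <= x -> x <= T -> t <= Num.min x s <= T.
  by move=> tx xT; rewrite le_min tx ts ge_min xT.
have fP e : e \in f -> (t <= Num.min e.1.2 s <= T) /\ (t <= Num.min e.2 s <= T).
  move=> /hf[t1 h12 h2]; split; apply: minP => //; first exact: le_trans h2.
  exact: le_trans h12.
apply: has_integral_sum => e /fP[e1 e2].
apply: has_integral_sum => e' /fP[e'1 e'2].
apply: has_integralZ; apply: has_integralD; first exact: hG.
apply: has_integralD; first exact: hG.
by apply: has_integralD; apply: has_integralZ; exact: hG.
Qed.

End HasIntegral.

Lemma step_norm2_le (R : realType) (t T s : R) (f : seq (R * R * R)) :
  (forall e, e \in f -> [/\ t <= e.1.2, e.1.2 <= e.2 & e.2 <= T]) ->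
  t <= s <= T ->
  ((step_norm2 f s)%:E
   <= \int[lebesgue_measure]_(r in `[t, T]) (step_fun f r ^+ 2)%:E)%E.
Proof.
move=> hf tsT.
pose G (x : R) (r : measurableTypeR R) : R := if (r : R) <= x then 1 else 0.
have hG x y : t <= x <= T -> t <= y <= T ->
    has_integral lebesgue_measure `[t, T]%classic
      (fun r => (G x r - G y r) ^+ 2) (1 * `|x - y|).
  wlog xy : x y / x <= y => [wl|] xtT ytT.
    have [xy|/ltW yx] := leP x y; first exact: wl.
    rewrite distrC (_ : (fun r => _) = (fun r => (G y r - G x r) ^+ 2)).
      exact: wl.
    by apply/funext => r; rewrite -[RHS]sqrrN opprB.
  have E : (fun r => (G x r - G y r) ^+ 2) = \1_(`]x, y]%classic).
    apply/funext => r; rewrite indicE mem_setE in_itv/= /G.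
    case: (leP r x) => rx /=.
      by rewrite (le_trans rx xy) subrr expr0n.
    by case: (r <= y); rewrite ?subr0 ?expr0n// sub0r sqrrN expr1n.
  have sub : `]x, y]%classic `<=` `[t, T]%classic.
    move=> r /=; rewrite !in_itv/= => /andP[xr ry].
    case/andP: xtT => tx _; case/andP: ytT => _ yT.
    by rewrite (le_trans tx (ltW xr)) (le_trans ry).
  rewrite E; split.
    apply: (integrableS measurableT) => //; exact: integrable_indic_itv.
  rewrite integral_indic//= (setIidl sub). rewrite lebesgue_measure_itv/= lte_fin mul1r.
  rewrite ler0_norm ?subr_le0// opprB -EFinB.
  by case: ltP => // yx; congr EFin; apply/eqP; rewrite eq_sym subr_eq0 eq_le yx xy.
have mI : @measurable _ (measurableTypeR R) `[t, T]%classic by exact: measurable_itv.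
have [hi hv] := step_int_second_moment mI hG hf tsT.
rewrite -[step_norm2 f s]mul1r -hv; apply: ge0_le_integral => //.
- by move=> r _; rewrite lee_fin sqr_ge0.
- exact: measurable_int hi.
- apply/measurable_EFinP; apply: measurable_funX.
  rewrite /step_fun; apply: measurable_sum => e.
  apply: measurable_fun_if => //; apply: measurable_and.
    exact: measurable_fun_ltr.
  exact: measurable_fun_ler.
- move=> r _; rewrite lee_fin.
  have -> : step_int G f s r = (if r <= s then 1 else 0) * step_fun f r.
    rewrite /step_int /step_fun mulr_sumr; rewrite !big_seq; apply: eq_bigr => e /hf[_ h _].
    rewrite /G !le_min; case: (leP r s) => rs; rewrite ?andbF ?subrr ?mulr0 ?mul0r// !andbT mul1r.
    case: (leP r e.1.2) => h1 /=; last by rewrite subr0; case: ifP; rewrite ?mulr1 ?mulr0.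
    by rewrite (le_trans h1 h) subrr mulr0.
  by rewrite exprMn; case: ifP => _; rewrite ?expr1n ?mul1r// expr0n mul0r sqr_ge0.
Qed.

Lemma brownian_second_moment (R : realType) (d : measure_display)
    (Omega : measurableType d) (P : probability Omega R) (N : nat) (T : R)
    (W : 'I_N -> R -> {RV P >-> R}) :
  brownian T W ->
  exists2 kappa : R, 0 <= kappa & forall j x y, 0 <= x <= T -> 0 <= y <= T ->
    has_integral P setT (fun w => (W j x w - W j y w) ^+ 2) (kappa * `|x - y|).
Proof.
move=> Wb; have [kappa k0 hk] := normal_second_moment R.
exists kappa => // j x y.
have mW r s : measurable_fun setT (fun w => W j s w - W j r w).
  by apply: measurable_funB.
wlog yx : x y / y <= x => [wl|] xT yT.
  have [yx|/ltW xy] := leP y x; first exact: wl.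
  rewrite distrC (_ : (fun w => _) = (fun w => (W j y w - W j x w) ^+ 2)).
    exact: wl.
  by apply/funext => w; rewrite -[RHS]sqrrN opprB.
have val : (\int[P]_w ((W j x w - W j y w) ^+ 2)%:E = (kappa * `|x - y|)%:E)%E.
  move: yx; rewrite le_eqVlt => /predU1P[->|yx].
    rewrite subrr normr0 mulr0 integral0_eq// => w _.
    by rewrite subrr expr0n.
  pose Y : {RV P >-> R} := HB.pack (fun w => W j x w - W j y w)
    (isMeasurableFun.Build _ _ _ _ _ (mW y x)).
  have sxy : 0 < Num.sqrt (x - y) by rewrite sqrtr_gt0 subr_gt0.
  have := hk _ sxy; rewrite sqr_sqrtr ?subr_ge0 1?ltW// => h.
  rewrite ger0_norm ?subr_ge0 1?ltW// -h.
  apply: (@ge0_expectation_density _ _ _ P Y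
    (normal_pdf 0 (Num.sqrt (x - y))) (fun z => z ^+ 2)).
  - exact: measurable_normal_pdf.
  - exact: normal_pdf_ge0.
  - exact: measurable_funX.
  - by move=> z; exact: sqr_ge0.
  - move=> B mB; apply: (brownian_normal Wb j _ yx _ mB).
      by case/andP: yT.
    by case/andP: xT.
split=> //; apply/integrableP; split.
  by apply/measurable_EFinP; apply: measurable_funX; exact: mW.
under eq_integral do rewrite /= ger0_norm ?sqr_ge0//.
by rewrite val ltry.
Qed.

Lemma has_integral0_ae (R : realType) (d : measure_display)
    (Omega : measurableType d) (P : {measure set Omega -> \bar R})
    (f : Omega -> R) :
  measurable_fun setT f -> (\int[P]_w ((f w) ^+ 2)%:E = 0)%E ->
  {ae P, forall w, f w = 0}.
Proof.
move=> mf f0.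
have mf2 : measurable_fun setT (fun w => ((f w) ^+ 2)%:E).
  by apply/measurable_EFinP; exact: measurable_funX.
have : ae_eq P setT (fun w => ((f w) ^+ 2)%:E) (cst 0%E).
  apply/(ae_eq_integral_abs P measurableT mf2).
  by under eq_integral do rewrite /= ger0_norm ?sqr_ge0//.
apply: filterS => w /(_ I)/= [] /eqP.
by rewrite sqrf_eq0 => /eqP.
Qed.

(** Two approximating sequences differ by step functions that tend to zero in
    the mean square, and so do their integrals by the isometry. *)
Lemma ito_integral_unique_at (R : realType) (d : measure_display)
    (Omega : measurableType d) (P : probability Omega R) (N : nat) (t T : R)
    (W : 'I_N -> R -> {RV P >-> R}) (j : 'I_N) (sigma : R -> R)
    (Z Z' : R -> Omega -> R) (s : R) :
  0 <= t -> brownian T W -> measurable_fun `[t, T] sigma ->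
  is_ito_integral P t T (fun s => W j s) sigma Z ->
  is_ito_integral P t T (fun s => W j s) sigma Z' ->
  t <= s <= T -> {ae P, forall w, Z s w = Z' s w}.
Proof.
move=> t0 Wb ms [mZ _ [f [hf f_lim Zf]]] [mZ' _ [g [hg g_lim Z'g]]] tsT.
have [kappa k0 hk] := brownian_second_moment Wb.
have mstep (h : seq (R * R * R)) : measurable_fun setT (step_int (fun s => W j s) h s).
  apply: measurable_sum => e; apply: measurable_funM => //.
  exact: measurable_funB.
have mstepf (h : seq (R * R * R)) : measurable_fun `[t, T] (step_fun h).
  apply: measurable_funTS; apply: measurable_sum => e.
  apply: measurable_fun_if => //; apply: measurable_and.
    exact: measurable_fun_ltr.
  exact: measurable_fun_ler.
pose h n := f n ++ [seq ((- e.1.1, e.1.2), e.2) | e <- g n].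
have hh n e : e \in h n -> [/\ t <= e.1.2, e.1.2 <= e.2 & e.2 <= T].
  rewrite mem_cat => /orP[/hf//|/mapP[e' e'g ->]] /=; exact: hg e'g.
have h_fun n r : step_fun (h n) r = step_fun (f n) r - step_fun (g n) r.
  rewrite /step_fun big_cat big_map/= -sumrN; congr (_ + _).
  by apply: eq_bigr => e _; case: ifP; rewrite ?oppr0.
have h_int n w : step_int (fun s => W j s) (h n) s w
    = step_int (fun s => W j s) (f n) s w - step_int (fun s => W j s) (g n) s w.
  rewrite /step_int big_cat big_map/= -sumrN; congr (_ + _).
  by apply: eq_bigr => e _; rewrite mulNr.
have hkT x y : t <= x <= T -> t <= y <= T ->
    has_integral P setT (fun w => (W j x w - W j y w) ^+ 2) (kappa * `|x - y|).
  by move=> /andP[tx xT] /andP[ty yT]; apply: hk; rewrite ?(le_trans t0 tx) ?(le_trans t0 ty).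
pose A n := (\int[P]_w ((step_int (fun s => W j s) (f n) s w - Z s w) ^+ 2)%:E)%E.
pose A' n := (\int[P]_w ((step_int (fun s => W j s) (g n) s w - Z' s w) ^+ 2)%:E)%E.
pose B n := (\int[lebesgue_measure]_(r in `[t, T])
  ((step_fun (f n) r - sigma r) ^+ 2)%:E)%E.
pose B' n := (\int[lebesgue_measure]_(r in `[t, T])
  ((step_fun (g n) r - sigma r) ^+ 2)%:E)%E.
pose U n := (3%:E * (A n + (kappa * 2)%:E * (B n + B' n) + A' n))%E.
have U_lim : U n @[n --> \oo] --> (0 : \bar R)%E.
  have -> : (0 = 3%:E * ((0 + (kappa * 2)%:E * (0 + 0)) + 0) :> \bar R)%E.
    by rewrite !adde0 !mule0 adde0 mule0.
  apply: cvgeZl => //; apply: cvgeD; last exact: Z'g.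
    by rewrite !adde0 mule0 adde0.
  apply: cvgeD; [by rewrite adde0 mule0|exact: Zf|].
  by apply: cvgeZl => //; exact: cvgeD.
have mZ0 : measurable_fun setT (fun w => Z s w - Z' s w).
  by apply: measurable_funB; [exact: mZ|exact: mZ'].
have hU n : (\int[P]_w ((Z s w - Z' s w) ^+ 2)%:E <= U n)%E.
  have [_ hv] := step_int_second_moment measurableT hkT (hh n) tsT.
  have hB : ((kappa * step_norm2 (h n) s)%:E <= (kappa * 2)%:E * (B n + B' n))%E.
    rewrite !EFinM -muleA; apply: lee_wpmul2l; first by rewrite lee_fin.
    apply: (le_trans (step_norm2_le (hh n) tsT)).
    have mB (q : seq (R * R * R)) :
        measurable_fun (`[t, T]%classic : set (measurableTypeR R))
          (fun r => ((step_fun q r - sigma r) ^+ 2)%:E).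
      by apply/measurable_EFinP; apply: measurable_funX; apply: measurable_funB;
        [exact: mstepf|exact: ms].
    have B0 (q : seq (R * R * R)) (r : measurableTypeR R) : (0 <= ((step_fun q r - sigma r) ^+ 2)%:E)%E.
      by rewrite lee_fin sqr_ge0.
    have mI : @measurable _ (measurableTypeR R) `[t, T]%classic := measurable_itv _.
    rewrite /B /B' -(ge0_integralD _ mI (fun r _ => B0 (f n) r) (mB (f n))
      (fun r _ => B0 (g n) r) (mB (g n))).
    have mBB := emeasurable_funD (mB (f n)) (mB (g n)).
    have BB0 (r : measurableTypeR R) : (0 <= ((step_fun (f n) r - sigma r) ^+ 2)%:E
        + ((step_fun (g n) r - sigma r) ^+ 2)%:E)%E by rewrite adde_ge0.
    rewrite -(ge0_integralZl_EFin _ mI (fun r _ => BB0 r) mBB)//.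
    apply: ge0_le_integral => //.
    - by move=> r _; rewrite lee_fin sqr_ge0.
    - by apply/measurable_EFinP; apply: measurable_funX; exact: mstepf.
    - exact: measurable_funeM.
    - move=> r _; rewrite -EFinD -EFinM lee_fin h_fun.
      have := sqr_ge0 (step_fun (f n) r - sigma r + (step_fun (g n) r - sigma r)).
      by rewrite !expr2; lra.
  apply: (@le_trans _ _ (3%:E * (A n + (kappa * step_norm2 (h n) s)%:E + A' n))%E);
    last by apply: lee_wpmul2l => //; apply: leeD => //; apply: leeD.
  rewrite -hv /A /A'.
  have m1 : measurable_fun setT (fun w => ((step_int (fun s => W j s) (f n) s w - Z s w) ^+ 2)%:E).
    apply/measurable_EFinP; apply: measurable_funX; apply: measurable_funB => //; exact: mZ.
  have m2 : measurable_fun setT (fun w => ((step_int (fun s => W j s) (h n) s w) ^+ 2)%:E).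
    by apply/measurable_EFinP; apply: measurable_funX.
  have m3 : measurable_fun setT (fun w => ((step_int (fun s => W j s) (g n) s w - Z' s w) ^+ 2)%:E).
    apply/measurable_EFinP; apply: measurable_funX; apply: measurable_funB => //; exact: mZ'.
  have s0 (x : R) : (0 <= (x ^+ 2)%:E)%E by rewrite lee_fin sqr_ge0.
  rewrite -ge0_integralD// -ge0_integralD//; last 2 first.
  - by move=> w _; rewrite adde_ge0.
  - exact: emeasurable_funD.
  rewrite -ge0_integralZl//; last 2 first.
  - by apply: emeasurable_funD => //; exact: emeasurable_funD.
  - by move=> w _; rewrite !adde_ge0.
  apply: ge0_le_integral => //.
  - by apply/measurable_EFinP; exact: measurable_funX.
  - apply: measurable_funeM; apply: emeasurable_funD => //; exact: emeasurable_funD.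
  move=> w _; rewrite -!EFinD -EFinM lee_fin h_int.
  set x := step_int _ (f n) s w; set y := step_int _ (g n) s w.
  have -> : Z s w - Z' s w = - (x - Z s w) + (x - y) + (y - Z' s w) by lra.
  move: (x - Z s w) (x - y) (y - Z' s w) => a b c.
  have := sqr_ge0 (a + b); have := sqr_ge0 (b - c); have := sqr_ge0 (a + c).
  by rewrite !expr2; lra.
have : (\int[P]_w ((Z s w - Z' s w) ^+ 2)%:E = 0)%E.
  apply/eqP; rewrite eq_le; apply/andP; split.
    by apply: (cvge_to_ge U_lim); exact: nearW.
  by apply: integral_ge0 => w _; rewrite lee_fin sqr_ge0.
move/(has_integral0_ae mZ0); apply: filterS => w /eqP.
by rewrite subr_eq0 => /eqP.
Qed.

(** The rationals are clamped to the interval, which also covers an interval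
    reduced to a point. *)
Lemma within_continuous_zero (R : realType) (t T : R) (phi : R -> R) :
  {within `[t, T], continuous phi} ->
  (forall q : rat, phi (Num.max t (Num.min (ratr q) T)) = 0) ->
  forall s, t <= s <= T -> phi s = 0.
Proof.
move=> phic phiq s tsT; apply/eqP; apply: contraT => phis.
have /subspace_continuousP/(_ s) := phic.
rewrite /= in_itv/= => /(_ tsT)/cvgrPdist_lt/(_ `|phi s|).
rewrite normr_gt0 => /(_ phis) [e /= e0 he].
have /rat_in_itvoo[q] : s - e < s + e by lra.
rewrite in_itv/= => /andP[q1 q2]; case/andP: tsT => ts sT.
set r := Num.max t (Num.min (ratr q) T).
have tT := le_trans ts sT.
have rtT : t <= r <= T by rewrite /r le_max lexx/= ge_max tT ge_min lexx orbT.
have sr : `|s - r| < e.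
  rewrite /r; case: (leP (ratr q) T) => h1; case: (leP t _) => h2;
    by rewrite ltr_norml; apply/andP; split; lra.
have := he r sr; rewrite /= in_itv/= => /(_ rtT).
by rewrite /from_subspace /r phiq subr0 ltxx.
Qed.

Lemma ito_integral_unique (R : realType) (d : measure_display)
    (Omega : measurableType d) (P : probability Omega R) (N : nat) (t T : R)
    (W : 'I_N -> R -> {RV P >-> R}) (j : 'I_N) (sigma : R -> R)
    (Z Z' : R -> Omega -> R) :
  0 <= t -> t <= T -> brownian T W -> measurable_fun `[t, T] sigma ->
  is_ito_integral P t T (fun s => W j s) sigma Z ->
  is_ito_integral P t T (fun s => W j s) sigma Z' ->
  {ae P, forall w s, t <= s <= T -> Z s w = Z' s w}.
Proof.
move=> t0 tT Wb ms iZ iZ'.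
pose c (q : rat) : R := Num.max t (Num.min (ratr q) T).
have cP q : t <= c q <= T by rewrite /c le_max lexx/= ge_max tT ge_min lexx orbT.
have aeq : {ae P, forall w, forall q, Z (c q) w = Z' (c q) w}.
  have : {ae P, forall w, forall n, let q := odflt 0 (unpickle n) in
      Z (c q) w = Z' (c q) w}.
    by apply/ae_foralln => n; exact: (ito_integral_unique_at t0 Wb ms iZ iZ').
  by apply: filterS => w h q; have := h (pickle q); rewrite pickleK.
have [_ Zc _] := iZ; have [_ Z'c _] := iZ'.
apply: filterS3 aeq Zc Z'c => w hq hc hc' s tsT.
apply/eqP; rewrite -subr_eq0; apply/eqP.
apply: (@within_continuous_zero R t T (fun s => Z s w - Z' s w)) => //.
  by move=> x; apply: cvgB; [exact: hc|exact: hc'].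
by move=> q; rewrite -/(c q) hq subrr.
Qed.

(** * Variation of constants along a path *)

Section Pathwise.
Context {R : realType}.
Implicit Types (t T r s : R) (f g k : R -> R).
Local Notation mu := (@lebesgue_measure R).

Lemma within_continuous_integrable t T f :
  {within `[t, T], continuous f} -> mu.-integrable `[t, T] (EFin \o f).
Proof. by move=> fc; apply: continuous_compact_integrable => //; exact: segment_compact. Qed.

Lemma within_continuous_measurable t T f :
  {within `[t, T], continuous f} ->
  measurable_fun (`[t, T]%classic : set (measurableTypeR R)) f.
Proof. by move=> fc; exact: subspace_continuous_measurable_fun. Qed.

Lemma itv_cc_sub t T r s : t <= r -> s <= T -> `[r, s]%classic `<=` `[t, T]%classic.
Proof.
move=> tr sT x /=; rewrite !in_itv/= => /andP[rx xs].
by rewrite (le_trans tr rx) (le_trans xs sT).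
Qed.

Lemma integrable_sub_itv t T r s f : t <= r -> s <= T ->
  mu.-integrable `[t, T] (EFin \o f) -> mu.-integrable `[r, s] (EFin \o f).
Proof. by move=> tr sT; apply: integrableS => //; exact: itv_cc_sub. Qed.

Lemma within_continuous_sub_itv t T r s f : t <= r -> s <= T ->
  {within `[t, T], continuous f} -> {within `[r, s], continuous f}.
Proof. by move=> tr sT; apply: continuous_subspaceW; exact: itv_cc_sub. Qed.

Lemma integrable_continuousM t T k g :
  {within `[t, T], continuous k} -> mu.-integrable `[t, T] (EFin \o g) ->
  mu.-integrable `[t, T] (EFin \o (fun r => k r * g r)).
Proof.
move=> kc gi; have [C C0 hC] := within_continuous_bounded kc.
have -> : EFin \o (fun r => k r * g r) = ((EFin \o k) \* (EFin \o g))%E by [].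
apply: integrableMr => //; first exact: within_continuous_measurable.
exists C; split; first exact: num_real.
move=> M CM x; rewrite /= in_itv/= => xtT; exact: le_trans (hC _ xtT) (ltW CM).
Qed.

(** Exchange of the order of integration over the triangle
    $t \le \rho \le r \le s$. *)
Lemma triangle_fubini t s k g :
  {within `[t, s], continuous k} -> mu.-integrable `[t, s] (EFin \o g) ->
  (\int[mu]_(r in `[t, s]) (k r * \int[mu]_(rho in `[t, r]) g rho)%:E
   = \int[mu]_(rho in `[t, s]) (g rho * \int[mu]_(r in `[rho, s]) k r)%:E)%E.
Proof.
move=> kc gi.
have mI (a b : R) : @measurable _ (measurableTypeR R) `[a, b]%classic.
  exact: measurable_itv.
have [C C0 hC] := within_continuous_bounded kc.
pose kk : measurableTypeR R -> R := k \_ `[t, s].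
pose gg : measurableTypeR R -> R := g \_ `[t, s].
have mk : measurable_fun setT kk.
  by apply/(measurable_restrictT _ (mI t s)); exact: within_continuous_measurable.
have mg : measurable_fun setT gg.
  apply/(measurable_restrictT _ (mI t s)).
  by apply/measurable_EFinP; exact: measurable_int gi.
have ggi : mu.-integrable setT (EFin \o gg).
  have -> : EFin \o gg = (EFin \o g) \_ `[t, s].
    by apply/funext => x; rewrite /gg /= !patchE; case: ifP.
  by apply/(integrable_mkcond _ (mI t s)).
pose F (z : measurableTypeR R * measurableTypeR R) : R :=
  if z.2 <= z.1 then kk z.1 * gg z.2 else 0.
have mF : measurable_fun setT F.
  apply: measurable_fun_if => //.
    by apply: measurable_fun_ler; [exact: measurable_snd|exact: measurable_fst].
  apply: measurable_funTS; apply: measurable_funM.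
    by apply: measurableT_comp => //; exact: measurable_fst.
  by apply: measurableT_comp => //; exact: measurable_snd.
have mF' : measurable_fun setT (EFin \o F) by exact/measurable_EFinP.
have kkC x : `|kk x| <= C * \1_(`[t, s]%classic : set (measurableTypeR R)) x.
  rewrite /kk patchE indicE; case: ifPn => xts; last by rewrite normr0 mulr0.
  by rewrite mulr1; apply: hC; move: xts; rewrite inE/= in_itv.
have Fi : (mu \x mu)%E.-integrable setT (EFin \o F).
  apply/(integrable12ltyP _ _ mF').
  pose G := (\int[mu]_x `|(EFin \o gg) x|)%E.
  have Gfin : (G < +oo)%E by case/integrableP: ggi.
  have G0 : (0 <= G)%E by exact: integral_ge0.
  apply: (@le_lt_trans _ _
    (\int[mu]_x ((fine G * C) * \1_(`[t, s]%classic : set (measurableTypeR R)) x)%:E)%E).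
    apply: ge0_le_integral => //.
    - by move=> x _; exact: integral_ge0.
    - apply: (measurable_fun_fubini_tonelli_F (m2 := mu) (fun z => `|(EFin \o F) z|)%E) => //.
      exact: measurableT_comp.
    - apply/measurable_EFinP; apply: measurable_funM => //; exact: measurable_indic.
    - move=> x _.
      apply: (@le_trans _ _ (\int[mu]_y (`|kk x|%:E * `|(EFin \o gg) y|))%E).
        apply: ge0_le_integral => //.
        + apply: measurableT_comp => //.
          by apply: measurableT_comp mF' _; exact: measurable_pair1.
        + apply: measurable_funeM; apply: measurableT_comp => //.
          exact/measurable_EFinP.
        + move=> y _; rewrite /F/= -EFinM lee_fin; case: ifP => _.
            by rewrite normrM.
          by rewrite normr0 mulr_ge0.
      rewrite ge0_integralZl//; last first.
        apply: measurableT_comp => //; exact/measurable_EFinP.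
      rewrite -/G -[G]fineK ?ge0_fin_numE// -EFinM lee_fin.
      rewrite mulrC -mulrA ler_wpM2l ?fine_ge0//.
  under eq_integral do rewrite EFinM.
  rewrite integralZl//; last first.
    by apply: (integrableS measurableT) => //; exact: integrable_indic_itv.
  rewrite integral_indic//= setIT lebesgue_measure_itv/=.
  by case: ifP => _; rewrite -?EFinD -?EFinM ?mule0 ltry.
have key := Fubini Fi.
transitivity (\int[mu]_x \int[mu]_y (F (x, y))%:E)%E.
  rewrite [LHS]integral_mkcond; apply: eq_integral => r _.
  rewrite patchE; case: ifPn => rts; last first.
    rewrite integral0_eq// => x _; rewrite /F/= /kk patchE (negbTE rts) mul0r.
    by case: ifP.
  move: (rts); rewrite inE/= in_itv/= => /andP[tr rs].
  have gir := integrable_sub_itv (lexx t) rs gi.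
  rewrite EFinM /Rintegral fineK; last exact: integrable_fin_num gir.
  rewrite -integralZl// [LHS]integral_mkcond; apply: eq_integral => x _.
  rewrite patchE mem_setE in_itv/= /F/= /kk /gg !patchE rts mem_setE in_itv/=.
  have [tx|tx] := leP t x => /=; last by rewrite mulr0; case: ifP.
  have [xr|xr] := leP x r => //=.
  by rewrite (le_trans xr rs) -EFinM.
rewrite [LHS]key.
rewrite [RHS]integral_mkcond; apply: eq_integral => x _.
rewrite patchE; case: ifPn => xts; last first.
  rewrite integral0_eq// => r _; rewrite /F/= /gg patchE (negbTE xts) mulr0.
  by case: ifP.
move: (xts); rewrite inE/= in_itv/= => /andP[tx xs].
have ki : mu.-integrable `[x, s] (EFin \o k).
  by apply: within_continuous_integrable; exact: within_continuous_sub_itv kc.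
rewrite EFinM /Rintegral fineK; last exact: integrable_fin_num ki.
rewrite -integralZl// [RHS]integral_mkcond; apply: eq_integral => r _.
rewrite patchE mem_setE in_itv/= /F/= /kk /gg !patchE xts mem_setE in_itv/=.
have [xr|xr] := leP x r => //=; rewrite (le_trans tx xr)/=.
by case: ifP => _; rewrite ?mul0r// -EFinM mulrC.
Qed.

Lemma antiderivative t T f :
  {within `[t, T], continuous f} ->
  exists2 F : R -> R, {within `[t, T], continuous F} &
    forall s, t < s < T -> is_derive s 1 F (f s).
Proof.
move=> fc; have [tT|Tt] := leP t T; last first.
  exists f => // s /andP[ts sT].
  by have := lt_trans (lt_trans ts sT) Tt; rewrite ltxx.
have fi := within_continuous_integrable fc.
exists (fun s => \int[mu]_(r in `[t, s]) f r).
  exact: parameterized_integral_continuous.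
move=> s /andP[ts sT].
have fs : {for s, continuous f}.
  apply: within_continuous_continuous fc _; first exact: lt_trans sT.
  by rewrite in_itv/= ts.
have [dF F's] := continuous_FTC1_closed sT fi ts fs.
by rewrite -F's derive1E; exact: derivableP.
Qed.

Lemma Rintegral_derive t T (F f : R -> R) r s :
  {within `[t, T], continuous F} -> {within `[t, T], continuous f} ->
  (forall x, t < x < T -> is_derive x 1 F (f x)) ->
  t <= r -> r <= s -> s <= T ->
  \int[mu]_(x in `[r, s]) f x = F s - F r.
Proof.
move=> Fc fc dF tr + sT; rewrite le_eqVlt => /predU1P[->|rs].
  by rewrite set_itv1 Rintegral_set1 subrr.
have Fc' := within_continuous_sub_itv tr sT Fc.
have inside x : x \in `]r, s[ -> t < x < T.
  rewrite in_itv/= => /andP[rx xs].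
  by rewrite (le_lt_trans tr rx) (lt_le_trans xs sT).
rewrite /Rintegral (@continuous_FTC2 _ f F r s)//.
- exact: within_continuous_sub_itv fc.
- have /continuous_within_itvP-/(_ rs)[_ h1 h2] := Fc'.
  by split=> // x /inside/dF[].
- by move=> x /inside/dF h; rewrite derive1E derive_val.
Qed.

(** The forcing term [delta] is only integrable, so the product rule for
    [expR (- al) * D] is replaced by an exchange of integrals. *)
Lemma variation_of_constants t T (a al D delta : R -> R) :
  t <= T ->
  {within `[t, T], continuous a} -> {within `[t, T], continuous al} ->
  (forall s, t < s < T -> is_derive s 1 al (a s)) ->
  mu.-integrable `[t, T] (EFin \o (fun r => a r * D r + delta r)) ->
  (forall s, t <= s <= T ->
     D s = \int[mu]_(r in `[t, s]) (a r * D r + delta r)) ->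
  mu.-integrable `[t, T] (EFin \o delta) /\
  forall s, t <= s <= T ->
    D s = \int[mu]_(r in `[t, s]) (expR (al s - al r) * delta r).
Proof.
move=> tT ac alc dal gi Dg.
set g := fun r => a r * D r + delta r in gi Dg.
have Dc : {within `[t, T], continuous D}.
  apply: (@subspace_eq_continuous _ _ _ (fun s => \int[mu]_(r in `[t, s]) g r)).
    by move=> s; rewrite inE/= in_itv/= => stT; rewrite -Dg.
  exact: parameterized_integral_continuous.
have cM (f1 f2 : R -> R) : {within `[t, T], continuous f1} ->
    {within `[t, T], continuous f2} -> {within `[t, T], continuous (fun r => f1 r * f2 r)}.
  by move=> c1 c2 x; apply: cvgM; [exact: c1|exact: c2].
pose E r := expR (- al r).
have Ec : {within `[t, T], continuous E}.
  move=> x; apply: (cvg_comp (fun r => - al r) expR); last exact: continuous_expR.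
  have h := alc x; exact: (cvgN h).
have dE s : t < s < T -> is_derive s 1 E (- (a s * E s)).
  move=> stT; have h := dal _ stT.
  have hN : is_derive s 1 (fun r => - al r) (- a s) by exact: is_deriveN.
  have := @is_derive1_comp _ expR (fun r => - al r) s _ _ (is_derive_expR _) hN.
  by rewrite mulrN mulrC.
pose k r := - (a r * E r).
have kc : {within `[t, T], continuous k}.
  by move=> x; apply: cvgN; apply: cM.
have aDi : mu.-integrable `[t, T] (EFin \o (fun r => a r * D r)).
  by apply: within_continuous_integrable; exact: cM.
have di : mu.-integrable `[t, T] (EFin \o delta).
  have -> : EFin \o delta = ((EFin \o g) \- (EFin \o (fun r => a r * D r)%R))%E.
    by apply/funext => r; rewrite /= -EFinB /g addrAC subrr add0r.
  exact: integrableB.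
split=> // s stT; have [ts sT] := andP stT.
have Egi := integrable_sub_itv (lexx t) sT (integrable_continuousM Ec gi).
have kDi : mu.-integrable `[t, s] (EFin \o (fun r => k r * D r)).
  apply: within_continuous_integrable.
  by apply: (within_continuous_sub_itv (lexx t) sT); exact: cM.
have gis := integrable_sub_itv (lexx t) sT gi.
have kD : \int[mu]_(r in `[t, s]) (k r * D r)
    = \int[mu]_(rho in `[t, s]) (g rho * (E s - E rho)).
  rewrite /Rintegral.
  transitivity (fine (\int[mu]_(r in `[t, s]) (k r * \int[mu]_(rho in `[t, r]) g rho)%:E)%E).
    congr fine; apply: eq_integral => r; rewrite inE/= in_itv/= => /andP[tr rs].
    by rewrite Dg// tr (le_trans rs sT).
  rewrite triangle_fubini//; last exact: (within_continuous_sub_itv (lexx t) sT).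
  congr fine; apply: eq_integral => r; rewrite inE/= in_itv/= => /andP[tr rs].
  by rewrite (Rintegral_derive Ec kc dE).
have EsD : \int[mu]_(r in `[t, s]) (E r * delta r) = E s * D s.
  transitivity (\int[mu]_(r in `[t, s]) (E r * g r + k r * D r)).
    by apply: eq_Rintegral => r _; rewrite /g /k; ring.
  rewrite RintegralD// kD -RintegralD//.
    rewrite Dg// -RintegralZl//; apply: eq_Rintegral => r _.
    by rewrite -[X in _ = _ * X]/(g r); move: (E r) (E s) (g r) => *; ring.
  have -> : EFin \o (fun rho => g rho * (E s - E rho))
      = EFin \o (fun rho => (E s - E rho) * g rho).
    by apply/funext => r /=; rewrite mulrC.
  apply: integrable_continuousM => //.
  apply: (within_continuous_sub_itv (lexx t) sT).
  by move=> x; apply: cvgB; [exact: cvg_cst|exact: Ec].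
transitivity (expR (al s) * \int[mu]_(r in `[t, s]) (E r * delta r)).
  by rewrite EsD /E mulrA -expRD subrr expR0 mul1r.
rewrite -RintegralZl//; last first.
  exact: integrable_sub_itv (lexx t) sT (integrable_continuousM Ec di).
by apply: eq_Rintegral => r _; rewrite mulrA -expRD.
Qed.

End Pathwise.
(** * Conditional expectations and the randomization *)

Section CondExp.
Context {R : realType} {d : measure_display} {Omega : measurableType d}
  (P : probability Omega R) (G : set (set Omega)).
Hypothesis G_sigma : sigma_algebra setT G.
Hypothesis G_sub : G `<=` @measurable _ Omega.
Local Notation OG := (g_sigma_algebraType G).

Lemma g_measurableE (A : set Omega) : @measurable _ OG A = G A.
Proof. by rewrite -[RHS](congr1 (fun F => F A) (sigma_algebra_id G_sigma)). Qed.

Lemma measurable_wrt_measurable (X : Omega -> R) :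
  measurable_wrt G X -> measurable_fun setT X.
Proof.
move=> mX _ B mB; apply: G_sub; rewrite -g_measurableE.
exact: mX.
Qed.

(** The event where the inequality fails belongs to the sub-sigma-algebra. *)
Lemma cond_exp_le (Z Z' : Omega -> R) :
  measurable_wrt G Z -> measurable_wrt G Z' ->
  P.-integrable setT (EFin \o Z) -> P.-integrable setT (EFin \o Z') ->
  (forall A, G A ->
     (\int[P]_(w in A) (Z w)%:E = \int[P]_(w in A) (Z' w)%:E)%E) ->
  {ae P, forall w, Z w <= Z' w}.
Proof.
move=> mZ mZ' iZ iZ' ZZ'.
pose A := [set w | Z' w < Z w].
have GA : G A.
  rewrite -g_measurableE; have := measurable_fun_ltr mZ' mZ.
  by move=> /(_ measurableT [set true] I); rewrite setTI; congr measurable.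
have mA : measurable A by exact: G_sub.
have iA (f : Omega -> R) : P.-integrable setT (EFin \o f) -> P.-integrable A (EFin \o f).
  exact: integrableS.
pose D w := Z w - Z' w.
have iD : P.-integrable A (EFin \o D).
  have -> : EFin \o D = ((EFin \o Z) \- (EFin \o Z'))%E by [].
  by apply: integrableB => //; exact: iA.
have D0 : (\int[P]_(w in A) `|(EFin \o D) w| = 0)%E.
  transitivity (\int[P]_(w in A) ((Z w)%:E - (Z' w)%:E))%E.
    apply: eq_integral => w; rewrite inE /A/= => ZZw.
    by rewrite -EFinB ger0_norm// subr_ge0 ltW.
  rewrite integralB_EFin//; [|exact: iA|exact: iA].
  rewrite ZZ'// subee//; apply: integrable_fin_num => //; exact: iA.
have /ae_eq_integral_abs := D0 => /(_ mA (measurable_int _ iD)).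
apply: filterS => w h; rewrite leNgt; apply/negP => Aw.
by have [/eqP] := h Aw; rewrite subr_eq0 gt_eqF.
Qed.

Lemma cond_exp_unique (X Z Z' : Omega -> R) :
  is_cond_exp P G X Z -> is_cond_exp P G X Z' -> {ae P, forall w, Z w = Z' w}.
Proof.
move=> [_ iZ mZ hZ] [_ iZ' mZ' hZ'].
have h1 := cond_exp_le mZ mZ' iZ iZ'.
have h2 := cond_exp_le mZ' mZ iZ' iZ.
have {}h1 : {ae P, forall w, Z w <= Z' w} by apply: h1 => A GA; rewrite hZ// hZ'.
have {}h2 : {ae P, forall w, Z' w <= Z w} by apply: h2 => A GA; rewrite hZ// hZ'.
by apply: filterS2 h1 h2 => w a b; apply/eqP; rewrite eq_le a b.
Qed.

Lemma ae_integrable (X Y : Omega -> R) :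
  measurable_fun setT Y -> {ae P, forall w, X w = Y w} ->
  P.-integrable setT (EFin \o X) -> P.-integrable setT (EFin \o Y).
Proof.
move=> mY XY /integrableP[mX iX]; apply/integrableP; split.
  exact/measurable_EFinP.
have <- : (\int[P]_w `|(EFin \o X) w| = \int[P]_w `|(EFin \o Y) w|)%E; last by [].
apply: ae_eq_integral => //.
- exact: measurableT_comp.
- by apply: measurableT_comp => //; exact/measurable_EFinP.
- by apply: filterS XY => w h _ /=; rewrite h.
Qed.

Context (tau : {RV P >-> R}).
Hypothesis tau_indep : independent_of tau G.

(** Independence says that the joint law of [tau] and the identity, valued in
    the sub-sigma-algebra, is a product measure. *)
Lemma ge0_expectation_indep (h : R -> R) (xi : Omega -> R) :
  measurable_fun setT h -> (forall x, 0 <= h x) ->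
  measurable_wrt G xi -> (forall w, 0 <= xi w) ->
  (\int[P]_w (h (tau w) * xi w)%:E
   = \int[P]_w (h (tau w))%:E * \int[P]_w (xi w)%:E)%E.
Proof.
move=> mh h0 mxi xi0.
have mid : measurable_fun setT (id : Omega -> OG).
  by move=> _ B mB; rewrite setTI; apply: G_sub; rewrite -g_measurableE.
pose idG : {mfun Omega >-> OG} :=
  HB.pack (id : Omega -> OG) (isMeasurableFun.Build _ _ _ _ _ mid).
have mpair : measurable_fun setT (fun w => (tau w, idG w)).
  exact: measurable_fun_pair.
pose pair_fun : {mfun Omega >-> (R * OG)%type} :=
  HB.pack (fun w => (tau w, idG w))
    (isMeasurableFun.Build _ _ _ _ _ mpair).
pose m1 := distribution P tau.
pose m2 := distribution P idG.
pose m' := distribution P pair_fun.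
have m'E B : measurable B -> (m1 \x m2)%E B = m' B.
  apply: product_measure_unique => A C mA mC.
  rewrite /m' /distribution /pushforward /=.
  rewrite /m1 /m2 /distribution /pushforward muleC -tau_indep//; last first.
    by rewrite -g_measurableE.
  by rewrite setIC; congr (P _).
pose f (z : R * OG) := (h z.1 * xi z.2)%:E.
have mf : measurable_fun setT f.
  apply/measurable_EFinP; apply: measurable_funM.
    by apply: measurableT_comp => //; exact: measurable_fst.
  by apply: measurableT_comp => //; exact: measurable_snd.
have f0 z : (0 <= f z)%E by rewrite lee_fin mulr_ge0.
have -> : (\int[P]_w (h (tau w) * xi w)%:E = \int[m']_z f z)%E.
  by rewrite ge0_integral_distribution.
have -> : (\int[m']_z f z = \int[(m1 \x m2)%E]_z f z)%E.
  apply: eq_measure_integral => A mA _; apply/esym; exact: (m'E A mA).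
rewrite fubini_tonelli1// /fubini_F.
have -> : (\int[P]_w (xi w)%:E = \int[m2]_w (xi w)%:E)%E.
  by rewrite ge0_integral_distribution//; exact/measurable_EFinP.
have -> : (\int[P]_w (h (tau w))%:E = \int[m1]_x (h x)%:E)%E.
  by rewrite ge0_integral_distribution//; exact/measurable_EFinP.
rewrite -ge0_integralZr//; last 3 first.
- exact/measurable_EFinP.
- by move=> x _; rewrite lee_fin.
- by apply: integral_ge0 => w _; rewrite lee_fin.
apply: eq_integral => x _; rewrite /f/=.
under eq_integral do rewrite EFinM.
rewrite ge0_integralZl// ?lee_fin//; first exact/measurable_EFinP.
by move=> w _; rewrite lee_fin.
Qed.

Lemma expectation_indep (h : R -> R) (c : R) (xi : Omega -> R) (A : set Omega) :
  measurable_fun setT h -> (forall x, 0 <= h x <= 1) ->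
  (\int[P]_w (h (tau w))%:E = c%:E)%E ->
  measurable_wrt G xi -> P.-integrable setT (EFin \o xi) -> G A ->
  (\int[P]_(w in A) (h (tau w) * xi w)%:E = c%:E * \int[P]_(w in A) (xi w)%:E)%E.
Proof.
move=> mh h01 hc mxi ixi GA.
have mA : measurable A by exact: G_sub.
have h0 x : 0 <= h x by case/andP: (h01 x).
have mAG : @measurable _ OG A by rewrite g_measurableE.
have mxi' := measurable_wrt_measurable mxi.
have part (g : R -> R) : measurable_fun setT g -> (forall x, 0 <= g x) ->
    (\int[P]_(w in A) (h (tau w) * g (xi w))%:E
     = c%:E * \int[P]_(w in A) (g (xi w))%:E)%E.
  move=> mg g0.
  have mgxi : measurable_wrt G (fun w => g (xi w) * \1_A w).
    apply: measurable_funM; last exact: measurable_indic.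
    exact: measurableT_comp.
  have := ge0_expectation_indep mh h0 mgxi; rewrite hc => E.
  transitivity (\int[P]_w (h (tau w) * (g (xi w) * \1_A w))%:E)%E.
    rewrite integral_mkcond; apply: eq_integral => w _.
    by rewrite patchE indicE; case: ifP => _; rewrite ?mulr1// !mulr0.
  rewrite E; last by move=> w; rewrite mulr_ge0.
  congr (_ * _)%E; rewrite [RHS]integral_mkcond; apply: eq_integral => w _.
  by rewrite patchE indicE; case: ifP => _; rewrite ?mulr1// !mulr0.
have mpos : measurable_fun setT (fun x : R => Num.max x 0) by exact: measurable_maxr.
have mneg : measurable_fun setT (fun x : R => Num.max (- x) 0) by exact: measurable_maxr.
have hp := part _ mpos (fun x => ltac:(by rewrite le_max lexx orbT)).
have hn := part _ mneg (fun x => ltac:(by rewrite le_max lexx orbT)).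
have iA : P.-integrable A (EFin \o xi) by exact: integrableS ixi.
have maxM (a b : R) : 0 <= a -> Num.max (a * b) 0 = a * Num.max b 0.
  by move=> a0; rewrite maxr_pMr// mulr0.
rewrite integralE [in RHS]integralE muleBr//; last first.
  by apply: fin_num_adde_defr; apply: integrable_pos_fin_num.
have -> : (\int[P]_(w in A) (fun x0 => (h (tau x0) * xi x0)%:E)^\+ w
    = \int[P]_(w in A) (h (tau w) * Num.max (xi w) 0)%:E)%E.
  by apply: eq_integral => w _; rewrite funeposE -EFin_max maxM.
have -> : (\int[P]_(w in A) (fun x0 => (h (tau x0) * xi x0)%:E)^\- w
    = \int[P]_(w in A) (h (tau w) * Num.max (- xi w) 0)%:E)%E.
  by apply: eq_integral => w _; rewrite funenegE -EFinN -EFin_max -mulrN maxM.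
rewrite hp hn; congr (_ * _ - _ * _)%E; apply: eq_integral => w _.
  by rewrite funeposE -EFin_max.
by rewrite funenegE -EFinN -EFin_max.
Qed.

(** The powers of [tau], cut off so as to be bounded and nonnegative everywhere
    and not only almost surely. *)
Definition truncated_power (k : nat) (x : R) : R :=
  if 0 <= x <= 1 then x ^+ k else 0.

Lemma measurable_truncated_power k : measurable_fun setT (truncated_power k).
Proof.
apply: measurable_fun_if => //.
by apply: measurable_and => //; exact: measurable_fun_ler.
Qed.

Lemma truncated_power01 k x : 0 <= truncated_power k x <= 1.
Proof.
rewrite /truncated_power; case: ifP => [/andP[x0 x1]|_]; last by rewrite lexx ler01.
by rewrite exprn_ge0// exprn_ile1.
Qed.

Hypothesis tau_uniform : uniform01 tau.

Lemma uniform01_ae : {ae P, forall w, 0 <= tau w <= 1}.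
Proof.
exists (tau @^-1` ~` `[0, 1]%classic); split.
- rewrite -[X in measurable X]setTI; apply: measurable_funP => //.
  by apply: measurableC; exact: measurable_itv.
- rewrite tau_uniform; last by apply: measurableC; exact: measurable_itv.
  rewrite /uniform_prob integral0_eq// => x /=; rewrite in_itv/= => /negP x01.
  by rewrite /uniform_pdf (negbTE x01).
- by move=> w /= h; rewrite in_itv/=; exact: h.
Qed.

Lemma uniform01_moment k :
  (\int[P]_w (truncated_power k (tau w))%:E = (k.+1%:R^-1)%:E)%E.
Proof.
rewrite (@ge0_expectation_density _ _ _ P tau (uniform_pdf 0 1)).
- transitivity (\int[@lebesgue_measure R]_(x in `[0%R, 1%R]) (x ^+ k)%:E)%E.
    rewrite [RHS]integral_mkcond; apply: eq_integral => x _.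
    rewrite patchE mem_setE in_itv/= /truncated_power /uniform_pdf.
    by case: ifP => _; rewrite ?mulr0// subr0 invr1 mulr1.
  pose F x : R := k.+1%:R^-1 * x ^+ k.+1.
  have dF (x : R) : is_derive x (1 : R) (F : R -> R) (x ^+ k : R).
    have hX : is_derive x 1 (fun y : R => y ^+ k.+1) (k.+1%:R * x ^+ k).
      have dX : derivable (fun y : R => y ^+ k.+1) x 1 by exact: exprn_derivable.
      apply: (is_derive_eq (derivableP dX)).
      by rewrite exp_derive -[_ *: 1]/(_ * 1) mulr1.
    have := is_deriveZ k.+1%:R^-1 hX.
    by move/is_derive_eq; apply; rewrite -[_ *: _]/(_ * _) mulKf// pnatr_eq0.
  have Fc : continuous F.
    by move=> x; apply: cvgM; [exact: cvg_cst|exact: exprn_continuous].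
  have Xc : {within `[0, 1], continuous (fun x : R => x ^+ k)}.
    by apply: continuous_subspaceT; exact: exprn_continuous.
  have := Rintegral_derive (continuous_subspaceT Fc) Xc (fun x _ => dF x)
    (lexx 0) ler01 (lexx 1).
  rewrite /F expr1n expr0n/= mulr0 subr0 mulr1 => <-.
  by rewrite fineK//; apply: integrable_fin_num => //; exact: within_continuous_integrable.
- exact: measurable_uniform_pdf.
- by move=> x; exact: uniform_pdf_ge0.
- exact: measurable_truncated_power.
- by move=> x; case/andP: (truncated_power01 k x).
- by move=> B mB; rewrite tau_uniform.
Qed.

(** A version of the conditional expectation of [xi + tau * eta], and of
    [tau * (xi + tau * eta)], when [xi] and [eta] are known: the moments of
    [tau] come out as constants. *)
Lemma cond_exp_mixture (xi eta X Z Z' : Omega -> R) :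
  measurable_wrt G xi -> measurable_wrt G eta ->
  P.-integrable setT (EFin \o eta) ->
  {ae P, forall w, X w = xi w + tau w * eta w} ->
  is_cond_exp P G X Z ->
  is_cond_exp P G (fun w => tau w * X w) Z' ->
  {ae P, forall w, Z w = xi w + 1 / 2 * eta w
    /\ Z' w = 1 / 2 * xi w + 1 / 3 * eta w}.
Proof.
move=> mxi meta ieta XE ZX Z'X.
have mxi' := measurable_wrt_measurable mxi.
have meta' := measurable_wrt_measurable meta.
have [iX iZ mZ hZ] := ZX; have [itX iZ' mZ' hZ'] := Z'X.
pose h k w := truncated_power k (tau w).
have mh k : measurable_fun setT (h k).
  by apply: measurableT_comp; [exact: measurable_truncated_power|exact: measurable_funP].
have hM k (f : Omega -> R) : P.-integrable setT (EFin \o f) ->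
    P.-integrable setT (EFin \o (fun w => h k w * f w)).
  move=> fi.
  have -> : EFin \o (fun w => h k w * f w) = ((EFin \o h k) \* (EFin \o f))%E by [].
  apply: integrableMr => //; exists 1; split; first exact: num_real.
  move=> M M1 w _ /=; have /andP[h0 h1] := truncated_power01 k (tau w).
  by rewrite ger0_norm// (le_trans h1)// ltW.
have XE1 : {ae P, forall w, X w = xi w + h 1 w * eta w}.
  apply: filterS2 XE uniform01_ae => w -> t01.
  by rewrite /h /truncated_power t01 expr1.
have tXE : {ae P, forall w, tau w * X w = h 1 w * xi w + h 2 w * eta w}.
  apply: filterS2 XE uniform01_ae => w -> t01.
  by rewrite /h /truncated_power t01 expr1 expr2; ring.
have ixi : P.-integrable setT (EFin \o xi).
  pose f w := X w - h 1 w * eta w.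
  apply: (@ae_integrable f) => //.
    by apply: filterS XE1 => w; rewrite /f => ->; rewrite addrK.
  have -> : EFin \o f = ((EFin \o X) \- (EFin \o (fun w => (h 1 w * eta w)%R)))%E by [].
  by apply: integrableB => //; exact: hM.
have mX := measurable_int _ iX; have mtX := measurable_int _ itX.
have cond_mix (c c' : R) (f g Y : Omega -> R) :
    P.-integrable setT (EFin \o f) -> P.-integrable setT (EFin \o g) ->
    P.-integrable setT (EFin \o Y) ->
    {ae P, forall w, Y w = f w + g w} ->
    (forall A, G A -> \int[P]_(w in A) (f w)%:E = c%:E * \int[P]_(w in A) (xi w)%:E)%E ->
    (forall A, G A -> \int[P]_(w in A) (g w)%:E = c'%:E * \int[P]_(w in A) (eta w)%:E)%E ->
    is_cond_exp P G Y (fun w => c * xi w + c' * eta w).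
  move=> fi gi Yi YE hf hg.
  have ci (a : R) (l : Omega -> R) : P.-integrable setT (EFin \o l) ->
      P.-integrable setT (EFin \o (fun w => a * l w)).
    move=> li.
    have -> : EFin \o (fun w => a * l w) = (fun w => a%:E * (EFin \o l) w)%E by [].
    exact: integrableZl.
  split=> //.
  - have -> : EFin \o (fun w => c * xi w + c' * eta w) =
      ((EFin \o (fun w => (c * xi w)%R)) \+ (EFin \o (fun w => (c' * eta w)%R)))%E by [].
    by apply: integrableD => //; exact: ci.
  - by apply: measurable_funD; apply: measurable_funM.
  - move=> A GA; have mA : measurable A by exact: G_sub.
    have iA (l : Omega -> R) : P.-integrable setT (EFin \o l) -> P.-integrable A (EFin \o l).
      exact: integrableS.
    transitivity (\int[P]_(w in A) ((c * xi w)%:E + (c' * eta w)%:E))%E => //.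
    rewrite integralD//; [|exact: iA (ci _ _ ixi)|exact: iA (ci _ _ ieta)].
    have -> : (\int[P]_(w in A) (Y w)%:E = \int[P]_(w in A) ((f w)%:E + (g w)%:E))%E.
      apply: ae_eq_integral => //.
      - exact: measurable_int (iA _ Yi).
      - by apply: emeasurable_funD; apply: measurable_int; [exact: (iA _ fi)|exact: (iA _ gi)].
      - by apply: filterS YE => w e _; rewrite e.
    rewrite integralD//; [|exact: iA fi|exact: iA gi].
    rewrite hf// hg//; congr (_ + _)%E.
      by under eq_integral do rewrite EFinM; rewrite integralZl//; exact: iA.
    by under eq_integral do rewrite EFinM; rewrite integralZl//; exact: iA.
have indep k (l : Omega -> R) A : measurable_wrt G l -> P.-integrable setT (EFin \o l) ->
    G A -> (\int[P]_(w in A) (h k w * l w)%:E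
      = (k.+1%:R^-1)%:E * \int[P]_(w in A) (l w)%:E)%E.
  move=> ml li GA; apply: expectation_indep => //.
  - exact: measurable_truncated_power.
  - exact: truncated_power01.
  - exact: uniform01_moment.
have e1 : is_cond_exp P G X (fun w => 1 * xi w + 2^-1 * eta w).
  apply: (cond_mix _ _ xi (fun w => h 1 w * eta w)) => //.
  - exact: hM.
  - by move=> A GA; rewrite mul1e.
  - by move=> A GA; exact: indep.
have e2 : is_cond_exp P G (fun w => tau w * X w) (fun w => 2^-1 * xi w + 3^-1 * eta w).
  apply: (cond_mix _ _ (fun w => h 1 w * xi w) (fun w => h 2 w * eta w)) => //.
  - exact: hM.
  - exact: hM.
  - by move=> A GA; exact: indep.
  - by move=> A GA; exact: indep.
apply: filterS2 (cond_exp_unique ZX e1) (cond_exp_unique Z'X e2) => w -> ->.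
by rewrite !mul1r.
Qed.

End CondExp.

(** Tonelli's theorem over the sub-sigma-algebra, applied to the positive and to
    the negative part. *)
Lemma measurable_wrt_Rintegral (R : realType) (d : measure_display)
    (Omega : measurableType d) (G : set (set Omega)) (t s : R) (k : R -> R)
    (delta : R -> Omega -> R) :
  measurable_fun (`[t, s]%classic : set (measurableTypeR R)) k ->
  measurable_fun (`[t, s] `*` setT)
    (fun z : measurableTypeR R * g_sigma_algebraType G => delta z.1 z.2) ->
  measurable_wrt G
    (fun w => \int[lebesgue_measure]_(r in `[t, s]) (k r * delta r w)).
Proof.
move=> mk mdelta.
pose D : set (measurableTypeR R * g_sigma_algebraType G) := `[t, s] `*` setT.
have mI : @measurable _ (measurableTypeR R) `[t, s]%classic by exact: measurable_itv.
have mD : measurable D by exact: measurableX.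
pose f (z : measurableTypeR R * g_sigma_algebraType G) := (k z.1 * delta z.1 z.2)%:E.
have mf : measurable_fun setT (f \_ D).
  apply/(measurable_restrictT _ mD); apply/measurable_EFinP.
  apply: measurable_funM => //.
  apply: (measurable_comp mI) => //; last by apply: measurable_funTS; exact: measurable_fst.
  by move=> _ [z [z1 _] <-].
have E w : (\int[lebesgue_measure]_(r in `[t, s]) (k r * delta r w)%:E
    = \int[lebesgue_measure]_r (f \_ D) (r, w))%E.
  rewrite integral_mkcond; apply: eq_integral => r _.
  rewrite !patchE; have [rts|rts] := boolP (r \in `[t, s]%classic).
    by rewrite ifT//; move: rts; rewrite !inE/D/=; split.
  by rewrite ifF//; apply/negbTE; move: rts; rewrite !notin_setE/D/= => h [].
have mp := @measurable_fun_fubini_tonelli_G _ _ (measurableTypeR R)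
  (g_sigma_algebraType G) R (@lebesgue_measure R) _ (measurable_funepos mf)
  (funepos_ge0 _).
have mn := @measurable_fun_fubini_tonelli_G _ _ (measurableTypeR R)
  (g_sigma_algebraType G) R (@lebesgue_measure R) _ (measurable_funeneg mf)
  (funeneg_ge0 _).
apply: (measurableT_comp (fine_measurable measurableT)).
apply: eq_measurable_fun (emeasurable_funB mp mn) => w _.
rewrite E integralE /fubini_G; congr (_ - _)%E; apply: eq_integral => r _.
  by rewrite !funeposE.
by rewrite !funenegE.
Qed.

Lemma completed_filtration_measurable (R : realType) (d : measure_display)
    (Omega : measurableType d) (P : probability Omega R) (N : nat)
    (W : 'I_N -> R -> {RV P >-> R}) (s : R) :
  measure_is_complete P ->
  completed_natural_filtration W s `<=` @measurable _ Omega.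
Proof.
move=> Pc; apply: smallest_sub; first exact: sigma_algebra_measurable.
move=> A [[i [r [B [_ mB ->]]]]|]; last exact: Pc.
by rewrite -[X in measurable X]setTI; exact: measurable_funP.
Qed.

Lemma completed_filtration_mono (R : realType) (d : measure_display)
    (Omega : measurableType d) (P : probability Omega R) (N : nat)
    (W : 'I_N -> R -> {RV P >-> R}) (s s' : R) : s <= s' ->
  completed_natural_filtration W s `<=` completed_natural_filtration W s'.
Proof.
move=> ss'; apply: sub_smallest2r; first exact: smallest_sigma_algebra.
move=> A [[i [r [B [/andP[r0 rs] mB ->]]]]|nA].
  by left; exists i, r, B; split=> //; rewrite r0 (le_trans rs).
by right.
Qed.

Lemma ito_integral0 (R : realType) (d : measure_display)
    (Omega : measurableType d) (P : probability Omega R) (t T : R)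
    (W : R -> Omega -> R) :
  is_ito_integral P t T W (fun _ => 0) (fun _ _ => 0).
Proof.
split.
- by move=> s _; exact: measurable_cst.
- by apply: nearW => w x; exact: cvg_cst.
- exists (fun=> [::]); split=> [//||s _].
    rewrite (_ : (fun _ => _) = cst 0%E); first exact: cvg_cst.
    apply/funext => n /=; rewrite integral0_eq// => r _.
    by rewrite /step_fun big_nil subr0 expr0n.
  rewrite (_ : (fun _ => _) = cst 0%E); first exact: cvg_cst.
  apply/funext => n /=; rewrite integral0_eq// => r _.
  by rewrite /step_int big_nil subr0 expr0n.
Qed.

(** * A Gronwall lemma for integrable functions *)

Lemma self_bounded_increments (R : realType) (t T K : R) (Phi : R -> R) :
  0 <= K -> (forall s, 0 <= Phi s) -> Phi t = 0 ->
  (forall r s, t <= r -> r <= s -> s <= T -> Phi s <= Phi r + K * (s - r) * Phi s) ->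
  forall s, t <= s <= T -> Phi s = 0.
Proof.
move=> K0 Phi0 Phit hPhi.
(* over a step of length [h] the increment is at most half of the final value *)
pose h := (2 * (K + 1))^-1.
have h0 : 0 < h by rewrite invr_gt0 mulr_gt0// ltr_wpDl.
have Kh : K * h <= 1 / 2.
  by rewrite /h ler_pdivrMr ?mulr_gt0 ?ltr_wpDl//; lra.
have step n s : t <= s <= T -> s <= t + n%:R * h -> Phi s = 0.
  elim: n s => [|n IH] s /andP[ts sT] sn.
    have -> // : s = t by apply/eqP; rewrite eq_le ts andbT; move: sn; rewrite mul0r addr0.
  pose r := Num.max t (s - h).
  have tr : t <= r by rewrite le_max lexx.
  have rs : r <= s by rewrite ge_max ts/=; lra.
  have sr : s - r <= h by rewrite /r; case: (leP t (s - h)) => ?; lra.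
  have Phir : Phi r = 0.
    apply: IH; first by rewrite tr (le_trans rs).
    move: sn; rewrite -natr1 mulrDl mul1r /r => sn.
    have nh : 0 <= n%:R * h by rewrite mulr_ge0 ?ler0n ?ltW.
    by case: (leP t (s - h)) => ?; lra.
  have := hPhi r s tr rs sT; rewrite Phir add0r => le.
  have : K * (s - r) * Phi s <= 1 / 2 * Phi s.
    by rewrite ler_wpM2r// (le_trans _ Kh)// ler_wpM2l.
  by have := Phi0 s => ? ?; apply/eqP; rewrite eq_le; apply/andP; split; lra.
move=> s stT; have [n hn] : exists n, s <= t + n%:R * h.
  exists (Num.truncn ((s - t) / h)).+1.
  rewrite -lerBlDl -ler_pdivrMr//.
  by apply: ltW; exact: truncnS_gt.
exact: step hn.
Qed.

Lemma integral_gronwall (R : realType) (t T K : R)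
    (phi : measurableTypeR R -> \bar R) :
  0 <= K -> measurable_fun setT phi -> (forall r, 0 <= phi r)%E ->
  (\int[lebesgue_measure]_(r in `[t, T]) phi r < +oo)%E ->
  (forall s, t <= s <= T ->
     (phi s <= K%:E * \int[lebesgue_measure]_(r in `[t, s]) phi r)%E) ->
  forall s, t <= s <= T -> phi s = 0%E.
Proof.
move=> K0 mphi phi0 phifin hphi.
have mI (i : interval R) : @measurable _ (measurableTypeR R) [set` i].
  exact: measurable_itv.
have mphiI (D : set (measurableTypeR R)) : measurable_fun D phi.
  exact: measurable_funTS.
pose I s := (\int[lebesgue_measure]_(r in `[t, s]) phi r)%E.
have I0 s : (0 <= I s)%E by exact: integral_ge0.
have Imono r s : r <= s -> (I r <= I s)%E.
  by move=> rs; apply: ge0_subset_integral => // x /=; rewrite !in_itv/= => /andP[-> /le_trans]; apply.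
have Ifin s : s <= T -> I s \is a fin_num.
  by move=> sT; rewrite ge0_fin_numE// (le_lt_trans (Imono _ _ sT)).
pose Phi s := fine (I s).
have Phi0 s : 0 <= Phi s by exact: fine_ge0.
have Phit : Phi t = 0 by rewrite /Phi /I set_itv1 integral_set1.
have hPhi r s : t <= r -> r <= s -> s <= T -> Phi s <= Phi r + K * (s - r) * Phi s.
  move=> tr rs sT.
  have E : I s = (I r + \int[lebesgue_measure]_(x in `]r, s]) phi x)%E.
    rewrite /I -ge0_integral_setU//.
    - by rewrite -itv_bndbnd_setU// bnd_simp.
    - rewrite disj_set2E; apply/eqP; rewrite -subset0 => x /=; rewrite !in_itv/=.
      by move=> [/andP[_ xr] /andP[rx _]]; move: (le_lt_trans xr rx); rewrite ltxx.
  have : (I s <= I r + (K * Phi s * (s - r))%:E)%E.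
    rewrite [leLHS]E leeD2l//.
    apply: (@le_trans _ _ (\int[lebesgue_measure]_(x in `]r, s]) (K * Phi s)%:E)%E).
      apply: ge0_le_integral => //.
      - move=> x; rewrite /= in_itv/= => /andP[rx xs].
        have xtT : t <= x <= T by rewrite (le_trans tr (ltW rx)) (le_trans xs sT).
        apply: (le_trans (hphi _ xtT)).
        rewrite EFinM /Phi fineK ?Ifin//; apply: lee_wpmul2l; first by rewrite lee_fin.
        exact: Imono.
    rewrite integral_cst//= lebesgue_measure_itv/= lte_fin.
    case: ltP => h; first by rewrite -EFinB -EFinM.
    by rewrite mule0 lee_fin mulr_ge0 ?mulr_ge0 ?subr_ge0.
  rewrite -[I s]fineK ?Ifin// -[I r]fineK ?Ifin ?(le_trans rs)// -EFinD lee_fin.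
  by rewrite -/(Phi s) -/(Phi r) mulrAC.
move=> s stT; apply/eqP; rewrite eq_le phi0 andbT.
apply: (le_trans (hphi _ stT)); rewrite -/(I s) -[I s]fineK ?Ifin ?(andP stT).2//.
by rewrite -/(Phi s) (self_bounded_increments K0 Phi0 Phit hPhi stT) mule0.
Qed.

(** * State, variation and feedback *)

Lemma ae_forall_fin (R : realType) (d : measure_display)
    (Omega : measurableType d) (P : {measure set Omega -> \bar R}) (I : finType)
    (Q : I -> Omega -> Prop) :
  (forall i, {ae P, forall w, Q i w}) -> {ae P, forall w i, Q i w}.
Proof. exact: (filter_forall (ae_filter_ringOfSetsType P)). Qed.

Section Model.
Context (R : realType) (N : nat) (disp : measure_display)
  (Omega : measurableType disp) (Pr : probability Omega R) (t T : R)
  (W : 'I_N -> R -> {RV Pr >-> R}) (tau : {RV Pr >-> R})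
  (a sigma : 'I_N -> R -> R) (x : 'cV[R]_N)
  (Xhat : R -> Omega -> 'cV[R]_(N + N)) (uhat : R -> Omega -> 'cV[R]_N)
  (al : 'I_N -> R -> R).
Hypothesis t_ge0 : 0 <= t.
Hypothesis t_leT : t <= T.
Hypothesis W_brownian : brownian T W.
Hypothesis a_cont : forall i, {within `[t, T], continuous (a i)}.
Hypothesis sigma_cont : forall i, {within `[t, T], continuous (sigma i)}.
Hypothesis al_cont : forall i, {within `[t, T], continuous (al i)}.
Hypothesis al_derive : forall i s, t < s < T -> is_derive s 1 (al i) (a i s).
Hypothesis Xhat_solves : solves_sde t T W (calA a) (fun s w => calB *m uhat s w)
  (Sigmabar sigma) (col_mx x 0) Xhat.
Local Notation mu := (@lebesgue_measure R).

Lemma AN_mulE r (v : 'cV[R]_N) i : (AN a r *m v) i ord0 = a i r * v i ord0.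
Proof. by rewrite mul_diag_mx !mxE. Qed.

Lemma calA_mull r (v : 'cV[R]_(N + N)) i :
  (calA a r *m v) (lshift N i) ord0 = a i r * v (lshift N i) ord0.
Proof.
by rewrite -[v]vsubmxK mul_block_col !mul0mx addr0 !col_mxEu AN_mulE.
Qed.

Lemma calA_mulr r (v : 'cV[R]_(N + N)) i :
  (calA a r *m v) (rshift N i) ord0 = a i r * v (rshift N i) ord0.
Proof.
by rewrite -[v]vsubmxK mul_block_col !mul0mx add0r !col_mxEd AN_mulE.
Qed.

Lemma calB_mull (v : 'cV[R]_N) i : (calB *m v) (lshift N i) ord0 = v i ord0.
Proof. by rewrite /calB mul_col_mx !mul1mx col_mxEu. Qed.

Lemma calB_mulr (v : 'cV[R]_N) i : (calB *m v) (rshift N i) ord0 = v i ord0.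
Proof. by rewrite /calB mul_col_mx !mul1mx col_mxEd. Qed.

(** The response of the state to the deviation of a control from [uhat]. *)
Definition response (u : R -> Omega -> 'cV[R]_N) (i : 'I_N) (s : R) (w : Omega) : R :=
  \int[mu]_(r in `[t, s])
    (expR (al i s - al i r) * (u r w i ord0 - uhat r w i ord0)).

Lemma SigmaN_measurable i j :
  measurable_fun `[t, T] (fun s => SigmaN sigma s i j).
Proof.
rewrite (_ : (fun _ => _) = if i == j then sigma i else cst 0).
  case: ifP => _; last exact: measurable_cst.
  by apply: within_continuous_measurable; exact: sigma_cont.
by apply/funext => s; rewrite !mxE; case: eqP; rewrite ?mulr1n ?mulr0n.
Qed.

(** The noises of [X] and of the first half of [Xhat] cancel, and there is no
    noise in [Y] and in the second half of [Xhat]; what remains are two linear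
    equations driven by the same difference of controls.  The weights [tau] and
    [1 - tau] of the control in [X] and in [(1 - tau) * Y] add up to one. *)
Lemma path_representation (u X Y : R -> Omega -> 'cV[R]_N) :
  is_state t T W a sigma x (fun s w => tau w *: u s w) X ->
  is_variation Pr t T a u Y ->
  {ae Pr, forall w i,
    mu.-integrable `[t, T] (EFin \o (fun r => u r w i ord0 - uhat r w i ord0)) /\
    forall s, t <= s <= T ->
      Y s w i ord0 = Xhat s w (rshift N i) ord0 + response u i s w /\
      X s w i ord0 + (1 - tau w) * Y s w i ord0
        = Xhat s w (lshift N i) ord0 + response u i s w}.
Proof.
move=> [Z [[I [Iito ZE]] Xeq]] Yeq.
have [Zh [[Ih [Ihito ZhE]] Xheq]] := Xhat_solves.
have noise1 : {ae Pr, forall w i j s, t <= s <= T -> Ih (lshift N i) j s w = I i j s w}.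
  apply: ae_forall_fin => i; apply: ae_forall_fin => j.
  apply: (ito_integral_unique t_ge0 t_leT W_brownian (SigmaN_measurable i j)) => //.
  have := Ihito (lshift N i) j.
  by congr is_ito_integral; apply/funext => s; rewrite /Sigmabar col_mxEu.
have noise2 : {ae Pr, forall w i j s, t <= s <= T -> Ih (rshift N i) j s w = 0}.
  apply: ae_forall_fin => i; apply: ae_forall_fin => j.
  apply: (@ito_integral_unique _ _ _ Pr N t T W j (fun=> 0) _ (fun _ _ => 0)) => //;
    last exact: ito_integral0.
  have := Ihito (rshift N i) j.
  by congr is_ito_integral; apply/funext => s; rewrite /Sigmabar col_mxEd mxE.
have {}Yeq : {ae Pr, forall w k,
    lebesgue_measure.-integrable `[t, T]
      (fun r => ((AN a r *m Y r w + u r w) k ord0)%:E) /\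
    forall s, t <= s <= T ->
      Y s w k ord0 = \int[lebesgue_measure]_(r in `[t, s]) (AN a r *m Y r w + u r w) k ord0}.
  apply: filterS Yeq => w h k; have [h1 h2] := h k; split=> // s stT.
  by rewrite h2// !mxE add0r addr0.
apply: filterS3 (filterI noise1 noise2) (filterI Yeq Xeq) Xheq.
move=> w [n1 n2] [hY hX] hXh i.
have [Yi Ys] := hY i; have [Xi Xs] := hX i.
have [Xhli Xhls] := hXh (lshift N i); have [Xhri Xhrs] := hXh (rshift N i).
pose delta r := u r w i ord0 - uhat r w i ord0.
pose gY r := a i r * Y r w i ord0 + u r w i ord0.
pose gX r := a i r * X r w i ord0 + tau w * u r w i ord0.
pose gl r := a i r * Xhat r w (lshift N i) ord0 + uhat r w i ord0.
pose gr r := a i r * Xhat r w (rshift N i) ord0 + uhat r w i ord0.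
have EY r : (AN a r *m Y r w + u r w) i ord0 = gY r.
  by rewrite mxE AN_mulE.
have EX r : (AN a r *m X r w + tau w *: u r w) i ord0 = gX r.
  by rewrite mxE AN_mulE [in LHS]mxE.
have El r : (calA a r *m Xhat r w + calB *m uhat r w) (lshift N i) ord0 = gl r.
  by rewrite mxE calA_mull calB_mull.
have Er r : (calA a r *m Xhat r w + calB *m uhat r w) (rshift N i) ord0 = gr r.
  by rewrite mxE calA_mulr calB_mulr.
have iY : mu.-integrable `[t, T] (EFin \o gY).
  by move: Yi; congr integrable; apply/funext => r; rewrite /= EY.
have iX : mu.-integrable `[t, T] (EFin \o gX).
  by move: Xi; congr integrable; apply/funext => r; rewrite /= EX.
have il : mu.-integrable `[t, T] (EFin \o gl).
  by move: Xhli; congr integrable; apply/funext => r; rewrite /= El.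
have ir : mu.-integrable `[t, T] (EFin \o gr).
  by move: Xhri; congr integrable; apply/funext => r; rewrite /= Er.
have sub (f : R -> R) s : t <= s <= T -> mu.-integrable `[t, T] (EFin \o f) ->
    mu.-integrable `[t, s] (EFin \o f).
  by move=> /andP[_ sT]; exact: integrable_sub_itv.
have iB (f g : R -> R) (A : set R) : @measurable _ (measurableTypeR R) A ->
    mu.-integrable A (EFin \o f) -> mu.-integrable A (EFin \o g) ->
    mu.-integrable A (EFin \o (fun r => f r - g r)).
  move=> mA fi gi.
  rewrite (_ : EFin \o _ = ((EFin \o f) \- (EFin \o g))%E) //; exact: integrableB.
have iZ (f : R -> R) c (A : set R) : @measurable _ (measurableTypeR R) A ->
    mu.-integrable A (EFin \o f) ->
    mu.-integrable A (EFin \o (fun r => c * f r)).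
  move=> mA fi.
  rewrite (_ : EFin \o _ = (fun r => c%:E * (EFin \o f) r)%E) //; exact: integrableZl.
have iD (f g : R -> R) (A : set R) : @measurable _ (measurableTypeR R) A ->
    mu.-integrable A (EFin \o f) -> mu.-integrable A (EFin \o g) ->
    mu.-integrable A (EFin \o (fun r => f r + g r)).
  move=> mA fi gi.
  rewrite (_ : EFin \o _ = ((EFin \o f) \+ (EFin \o g))%E) //; exact: integrableD.
have mI s : @measurable _ (measurableTypeR R) `[t, s]%classic by exact: measurable_itv.
pose D2 r := Y r w i ord0 - Xhat r w (rshift N i) ord0.
have E2 r : a i r * D2 r + delta r = gY r - gr r by rewrite /D2 /delta /gY /gr; ring.
have [di hD2] : mu.-integrable `[t, T] (EFin \o delta) /\
    forall s, t <= s <= T -> D2 s = response u i s w.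
  apply: (@variation_of_constants R t T (a i) (al i) D2 delta t_leT (@a_cont i)
    (@al_cont i) (@al_derive i)).
    have -> : (fun r => a i r * D2 r + delta r) = (fun r => gY r - gr r) by apply/funext.
    exact: iB.
  move=> s stT; under eq_Rintegral do rewrite E2.
  rewrite RintegralB//; [|exact: sub|exact: sub].
  rewrite /D2 Ys// Xhrs// col_mxEd mxE add0r ZhE big1 ?addr0; last by move=> j _; exact: n2.
  by congr (_ - _); apply: eq_Rintegral => r _.
split=> // s stT; split; first by rewrite -hD2// /D2 addrC subrK.
pose D1 r := X r w i ord0 + (1 - tau w) * Y r w i ord0 - Xhat r w (lshift N i) ord0.
have E1 r : a i r * D1 r + delta r = gX r + (1 - tau w) * gY r - gl r.
  by rewrite /D1 /delta /gX /gY /gl; ring.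
have [_ hD1] : mu.-integrable `[t, T] (EFin \o delta) /\
    forall s, t <= s <= T -> D1 s = response u i s w.
  apply: (@variation_of_constants R t T (a i) (al i) D1 delta t_leT (@a_cont i)
    (@al_cont i) (@al_derive i)).
    have -> : (fun r => a i r * D1 r + delta r)
      = (fun r => gX r + (1 - tau w) * gY r - gl r) by apply/funext.
    by apply: iB => //; apply: iD => //; exact: iZ.
  move=> {}s {}stT; under eq_Rintegral do rewrite E1.
  rewrite RintegralB//; [|by apply: iD => //; [exact: sub|apply: iZ => //; exact: sub]|exact: sub].
  rewrite RintegralD//; [|exact: sub|by apply: iZ => //; exact: sub].
  rewrite RintegralZl//; last exact: sub.
  rewrite /D1 Ys// Xhls// Xs// col_mxEu.
  have -> : Zh s w (lshift N i) ord0 = Z s w i ord0.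
    by rewrite ZhE ZE; apply: eq_bigr => j _; exact: n1.
  have RX : \int[mu]_(r in `[t, s]) (AN a r *m X r w + tau w *: u r w) i ord0
      = \int[mu]_(r in `[t, s]) gX r by apply: eq_Rintegral => r _; exact: EX.
  have RY : \int[mu]_(r in `[t, s]) (AN a r *m Y r w + u r w) i ord0
      = \int[mu]_(r in `[t, s]) gY r by apply: eq_Rintegral => r _; exact: EY.
  have Rl : \int[mu]_(r in `[t, s])
        (calA a r *m Xhat r w + calB *m uhat r w) (lshift N i) ord0
      = \int[mu]_(r in `[t, s]) gl r by apply: eq_Rintegral => r _; exact: El.
  rewrite RX RY Rl; ring.
by rewrite -hD1// /D1 [RHS]addrC subrK.
Qed.

Hypothesis Pr_complete : measure_is_complete Pr.
Hypothesis tau_uniform : uniform01 tau.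
Hypothesis tau_indep : independent_of tau (completed_natural_filtration W T).
Hypothesis Xhat_adapted : adapted (completed_natural_filtration W) t T Xhat.
Context (L : R).
Hypothesis uhat_admissible : admissible Pr (completed_natural_filtration W) t T L uhat.
Local Notation fil := (completed_natural_filtration W).

Definition response_vec (u : R -> Omega -> 'cV[R]_N) (s : R) (w : Omega) : 'cV[R]_N :=
  \col_i response u i s w.

Lemma response_measurable u i s :
  admissible Pr fil t T L u -> t <= s <= T -> measurable_wrt (fil s) (response u i s).
Proof.
move=> u_adm stT; have [ts sT] := andP stT.
apply: measurable_wrt_Rintegral.
  apply: within_continuous_measurable.
  have c := within_continuous_sub_itv (lexx t) sT (@al_cont i).
  move=> r; apply: (cvg_comp (fun r => al i s - al i r) expR); last exact: continuous_expR.
  have h := c r; exact: (cvgB (cvg_cst _) h).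
have [mu_ _] := u_adm i; have [muh _] := uhat_admissible i.
by apply: measurable_funB; [exact: mu_|exact: muh].
Qed.

Lemma calT_mul (v : 'cV[R]_(N + N)) i :
  [/\ usubmx (calT *m v) (lshift N i) ord0
        = v (lshift N i) ord0 - 1 / 2 * v (rshift N i) ord0,
      usubmx (calT *m v) (rshift N i) ord0 = v (rshift N i) ord0,
      dsubmx (calT *m v) (lshift N i) ord0
        = 1 / 2 * v (lshift N i) ord0 - 1 / 6 * v (rshift N i) ord0 &
      dsubmx (calT *m v) (rshift N i) ord0 = 1 / 2 * v (rshift N i) ord0].
Proof.
rewrite -[v]vsubmxK; move: (usubmx v) (dsubmx v) => p q.
rewrite /calT mul_col_mx col_mxKu col_mxKd !mul_block_col !mul1mx !mul0mx !add0r.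
rewrite !mul_scalar_mx !col_mxEu !col_mxEd.
by split; rewrite ?mxE; lra.
Qed.

(** Both blocks of [F] are conditional expectations of mixtures
    [xi + tau * eta] with [xi] and [eta] known at time [s]: [eta] is the second
    half of the state and [xi] the difference of its halves. *)
Lemma F_response u F :
  admissible Pr fil t T L u ->
  is_F t T fil W tau a sigma x u F ->
  forall s, t <= s <= T ->
    {ae Pr, forall w, F s w = calT *m (Xhat s w + calB *m response_vec u s w)}.
Proof.
move=> u_adm [X [Y [Xst Yst FE]]] s stT; have [ts sT] := andP stT.
have rep := path_representation Xst Yst.
have Gs : sigma_algebra setT (fil s) by exact: smallest_sigma_algebra.
have Gm := completed_filtration_measurable (W := W) (s := s) Pr_complete.
have Gi : independent_of tau (fil s).
  move=> A B GA mB; apply: tau_indep => //.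
  exact: (completed_filtration_mono sT) GA.
pose eta i w := Xhat s w (rshift N i) ord0 + response u i s w.
pose xi i w := Xhat s w (lshift N i) ord0 - Xhat s w (rshift N i) ord0.
have meta i : measurable_wrt (fil s) (eta i).
  apply: measurable_funD; first exact: Xhat_adapted.
  exact: response_measurable.
have mxi i : measurable_wrt (fil s) (xi i).
  by apply: measurable_funB; exact: Xhat_adapted.
have FX i : is_cond_exp Pr (fil s) (fun w => X s w i ord0)
      (fun w => usubmx (F s w) (lshift N i) ord0) /\
    is_cond_exp Pr (fil s) (fun w => tau w * X s w i ord0)
      (fun w => dsubmx (F s w) (lshift N i) ord0).
  have [h1 h2] := FE s stT (lshift N i); split.
    by move: h1; congr is_cond_exp; apply/funext => w; rewrite col_mxEu.
  by move: h2; congr is_cond_exp; apply/funext => w; rewrite col_mxEu.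
have FY i : is_cond_exp Pr (fil s) (fun w => Y s w i ord0)
      (fun w => usubmx (F s w) (rshift N i) ord0) /\
    is_cond_exp Pr (fil s) (fun w => tau w * Y s w i ord0)
      (fun w => dsubmx (F s w) (rshift N i) ord0).
  have [h1 h2] := FE s stT (rshift N i); split.
    by move: h1; congr is_cond_exp; apply/funext => w; rewrite col_mxEd.
  by move: h2; congr is_cond_exp; apply/funext => w; rewrite col_mxEd.
have YE i : {ae Pr, forall w, Y s w i ord0 = eta i w}.
  by apply: filterS rep => w /(_ i)[_ /(_ s stT)[-> _]].
have XE i : {ae Pr, forall w, X s w i ord0 = xi i w + tau w * eta i w}.
  apply: filterS rep => w /(_ i)[_ /(_ s stT)[hY hX]].
  have -> : X s w i ord0 = Xhat s w (lshift N i) ord0 + response u i s w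
      - (1 - tau w) * Y s w i ord0 by rewrite -hX addrK.
  by rewrite hY /xi /eta; ring.
have ieta i : Pr.-integrable setT (EFin \o eta i).
  apply: (ae_integrable _ (YE i)); first exact: (measurable_wrt_measurable Gs Gm).
  by have [[]] := FY i.
have i0 : Pr.-integrable setT (EFin \o (fun=> 0 : R)) by exact: integrable0.
have m0 : measurable_wrt (fil s) (fun=> 0 : R) by exact: measurable_cst.
have top : {ae Pr, forall w i,
    usubmx (F s w) (lshift N i) ord0 = xi i w + 1 / 2 * eta i w /\
    dsubmx (F s w) (lshift N i) ord0 = 1 / 2 * xi i w + 1 / 3 * eta i w}.
  apply: ae_forall_fin => i.
  exact: (cond_exp_mixture Gs Gm Gi tau_uniform (mxi i) (meta i) (ieta i) (XE i)
    (FX i).1 (FX i).2).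
have bot : {ae Pr, forall w i,
    usubmx (F s w) (rshift N i) ord0 = eta i w + 1 / 2 * 0 /\
    dsubmx (F s w) (rshift N i) ord0 = 1 / 2 * eta i w + 1 / 3 * 0}.
  apply: ae_forall_fin => i.
  have YE0 : {ae Pr, forall w, Y s w i ord0 = eta i w + tau w * 0}.
    by apply: filterS (YE i) => w ->; rewrite mulr0 addr0.
  exact: (cond_exp_mixture Gs Gm Gi tau_uniform (meta i) m0 i0 YE0
    (FY i).1 (FY i).2).
apply: filterS2 top bot => w htop hbot.
set v := Xhat s w + _.
have vl i : v (lshift N i) ord0 = Xhat s w (lshift N i) ord0 + response u i s w.
  by rewrite mxE calB_mull mxE.
have vr i : v (rshift N i) ord0 = eta i w by rewrite mxE calB_mulr mxE.
rewrite -[LHS]vsubmxK -[RHS]vsubmxK.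
congr col_mx; apply/matrixP => k l; rewrite (ord1 l); case: (split_ordP k) => i ->;
  have [c1 c2 c3 c4] := calT_mul v i; have [t1 t2] := htop i; have [b1 b2] := hbot i;
  rewrite ?c1 ?c2 ?c3 ?c4 ?t1 ?t2 ?b1 ?b2 ?vl ?vr /xi /eta; lra.
Qed.

Lemma response_self s w : response_vec uhat s w = 0.
Proof.
apply/matrixP => i j; rewrite !mxE /response (_ : (fun _ => _) = cst 0).
  by rewrite Rintegral_cst ?mul0r//; exact: measurable_itv.
by apply/funext => r; rewrite subrr mulr0.
Qed.

(** * Uniqueness of the feedback control *)

Let strip : set (measurableTypeR R * Omega) := `[t, T] `*` setT.

Let measurable_strip : measurable strip.
Proof. by apply: measurableX => //; exact: measurable_itv. Qed.

Lemma admissible_measurable (u : R -> Omega -> 'cV[R]_N) i : admissible Pr fil t T L u ->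
  measurable_fun setT ((fun z : measurableTypeR R * Omega => u z.1 z.2 i ord0) \_ strip).
Proof.
move=> u_adm; apply/(measurable_restrictT _ measurable_strip).
have [mu_ _] := u_adm i; have TT : t <= T <= T by rewrite t_leT lexx.
have Gs : sigma_algebra setT (fil T) by exact: smallest_sigma_algebra.
have Gm := completed_filtration_measurable (W := W) (s := T) Pr_complete.
pose phi (z : measurableTypeR R * Omega) :
  measurableTypeR R * g_sigma_algebraType (fil T) := z.
have m1 : measurable_fun setT (fst : measurableTypeR R * Omega -> measurableTypeR R).
  exact: measurable_fst.
have m2 : measurable_fun setT
    (snd : measurableTypeR R * Omega -> g_sigma_algebraType (fil T)).
  move=> _ B mB; have mB' : measurable (B : set Omega).
    by apply: Gm; rewrite -(g_measurableE Gs).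
  have ms : measurable_fun setT (snd : measurableTypeR R * Omega -> Omega).
    exact: measurable_snd.
  exact: (ms measurableT _ mB').
have mphi : measurable_fun setT phi.
  rewrite (_ : phi = fun z => (z.1, z.2)); first exact: (measurable_fun_pair m1 m2).
  by apply/funext => -[].
apply: (@measurable_comp _ _ _ _ _ _ (`[t, T] `*` setT)
  (fun z : measurableTypeR R * g_sigma_algebraType (fil T) => u z.1 z.2 i ord0) strip phi) => //.
- by apply: measurableX => //; exact: measurable_itv.
- by move=> _ [z zs <-].
- exact: mu_.
- exact: measurable_funTS.
Qed.

Lemma admissible_sqr (u : R -> Omega -> 'cV[R]_N) i : admissible Pr fil t T L u ->
  (\int[(mu \x Pr)%E]_z ((((fun z : measurableTypeR R * Omega => u z.1 z.2 i ord0)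
     \_ strip) z) ^+ 2)%:E <= (L ^+ 2)%:E)%E.
Proof.
move=> u_adm; have mu_ := admissible_measurable i u_adm.
rewrite (fubini_tonelli2 (m1 := mu) (m2 := Pr)); last 2 first.
- by apply/measurable_EFinP; exact: measurable_funX.
- by move=> z; rewrite lee_fin sqr_ge0.
apply: le_trans ((u_adm i).2); rewrite le_eqVlt; apply/orP; left; apply/eqP.
apply: eq_integral => w _; rewrite /fubini_G [RHS]integral_mkcond.
apply: eq_integral => r _; rewrite !patchE.
have -> : ((r, w) \in strip) = (r \in `[t, T]%classic).
  by apply/idP/idP; rewrite !inE/strip/= => // -[].
by case: ifP => _; rewrite ?expr0n//= real_normK ?num_real.
Qed.

Lemma response_bound : exists2 C, 0 <= C &
  forall (u : R -> Omega -> 'cV[R]_N) w i s, t <= s <= T ->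
  mu.-integrable `[t, T] (EFin \o (fun r => u r w i ord0 - uhat r w i ord0)) ->
  (`|response u i s w|%:E
   <= C%:E * \int[mu]_(r in `[t, s]) `|u r w i ord0 - uhat r w i ord0|%:E)%E.
Proof.
have /choice[c hc] : forall i, exists C,
    0 <= C /\ forall s, t <= s <= T -> `|al i s| <= C.
  by move=> i; have [C C0 hC] := within_continuous_bounded (@al_cont i); exists C.
have C0 : 0 <= \sum_i expR (c i + c i) by apply: sumr_ge0 => i _; exact: expR_ge0.
exists (\sum_i expR (c i + c i)) => // u w i s stT di; have [ts sT] := andP stT.
have dis := integrable_sub_itv (lexx t) sT di.
have kc : {within `[t, s], continuous (fun r => expR (al i s - al i r))}.
  have h := within_continuous_sub_itv (lexx t) sT (@al_cont i).
  move=> r; apply: (cvg_comp (fun r => al i s - al i r) expR); last exact: continuous_expR.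
  by have hr := h r; exact: (cvgB (cvg_cst _) hr).
have kdi := integrable_continuousM kc dis.
have mI : @measurable _ (measurableTypeR R) `[t, s]%classic by exact: measurable_itv.
have [c0 hci] := hc i.
have ek r : t <= r <= T -> expR (al i s - al i r) <= \sum_j expR (c j + c j).
  move=> rtT; apply: (@le_trans _ _ (expR (c i + c i))).
    rewrite ler_expR; apply: (le_trans (ler_norm _)).
    by apply: (le_trans (ler_normB _ _)); apply: lerD; exact: hci.
  by rewrite (bigD1 i)//= lerDl sumr_ge0// => j _; exact: expR_ge0.
rewrite /response EFin_normr_Rintegral//.
apply: (le_trans (le_abse_integral _ mI _)); first exact: measurable_int kdi.
have mabs : measurable_fun (`[t, s]%classic : set (measurableTypeR R))
    (fun r => `|u r w i ord0 - uhat r w i ord0|%:E).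
  apply/measurable_EFinP; apply: measurableT_comp => //.
  by apply/measurable_EFinP; exact: measurable_int dis.
rewrite -ge0_integralZl// ?lee_fin//.
apply: ge0_le_integral => //.
- by apply: measurableT_comp => //; exact: measurable_int kdi.
- exact: measurable_funeM.
move=> r; rewrite /= in_itv/= => /andP[tr rs].
rewrite -EFinM lee_fin normrM ger0_norm ?expR_ge0// ler_wpM2r// ek// tr/=.
exact: le_trans sT.
Qed.

(** The expected deviation $\mathbb E\sum_i |u_i - \hat u_i|$ at time $s$ is
    bounded by a multiple of its own integral up to time $s$. *)
Lemma deviation_zero (u : R -> Omega -> 'cV[R]_N) (D : R -> 'M[R]_N) (C : R) :
  admissible Pr fil t T L u ->
  {ae Pr, forall w i,
    mu.-integrable `[t, T] (EFin \o (fun r => u r w i ord0 - uhat r w i ord0))} ->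
  0 <= C -> (forall s, t <= s <= T -> forall i j, `|D s i j| <= C) ->
  (forall s, t <= s <= T ->
     {ae Pr, forall w, u s w - uhat s w = D s *m response_vec u s w}) ->
  forall s, t <= s <= T -> {ae Pr, forall w, u s w = uhat s w}.
Proof.
move=> u_adm u_int C0 DC uD.
pose ut i := (fun z : measurableTypeR R * Omega => u z.1 z.2 i ord0) \_ strip.
pose uh i := (fun z : measurableTypeR R * Omega => uhat z.1 z.2 i ord0) \_ strip.
pose e i (z : measurableTypeR R * Omega) : \bar R := `|ut i z - uh i z|%:E.
have mut i : measurable_fun setT (ut i) by exact: admissible_measurable.
have muh i : measurable_fun setT (uh i) by exact: admissible_measurable.
have me i : measurable_fun setT (e i).
  by apply/measurable_EFinP; apply: measurableT_comp => //; exact: measurable_funB.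
have e0 i z : (0 <= e i z)%E by rewrite lee_fin.
have mI (s : R) : @measurable _ (measurableTypeR R) `[t, s]%classic.
  exact: measurable_itv.
have mS (s : R) : measurable (`[t, s] `*` setT : set (measurableTypeR R * Omega)).
  exact: measurableX.
have eE i r w : t <= r <= T -> e i (r, w) = `|u r w i ord0 - uhat r w i ord0|%:E.
  move=> rtT; have rwS : (r, w) \in strip.
    by apply/mem_set; split=> //=; rewrite in_itv.
  by rewrite /e /ut /uh !patchE rwS.
pose phi (r : measurableTypeR R) : \bar R := (\sum_i \int[Pr]_w e i (r, w))%E.
have mphii i : measurable_fun setT (fun r : measurableTypeR R => \int[Pr]_w e i (r, w))%E.
  exact: (measurable_fun_fubini_tonelli_F (m2 := Pr) (e i)).
have phii0 i r : (0 <= \int[Pr]_w e i (r, w))%E by exact: integral_ge0.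
have mphi : measurable_fun setT phi by exact: emeasurable_sum.
have phi0 r : (0 <= phi r)%E by exact: sume_ge0.
have phi_int s : (\int[mu]_(r in `[t, s]) phi r
    = \sum_i \int[Pr]_w \int[mu]_(r in `[t, s]) e i (r, w))%E.
  rewrite ge0_integral_sum//; last by move=> i; exact: measurable_funTS.
  apply: eq_bigr => i _; rewrite integral_mkcond.
  pose es := (e i) \_ (`[t, s] `*` setT).
  have mes : measurable_fun setT es.
    apply/(measurable_restrictT _ (mS s)); exact: measurable_funTS.
  have es0 z : (0 <= es z)%E by rewrite /es patchE; case: ifP.
  have inS (r : measurableTypeR R) (w : Omega) :
      ((r, w) \in `[t, s] `*` setT) = (r \in `[t, s]%classic).
    by apply/idP/idP; rewrite !inE/= => // -[].
  transitivity (\int[mu]_r \int[Pr]_w es (r, w))%E.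
    apply: eq_integral => r _; rewrite patchE; case: ifPn => rs.
      by apply: eq_integral => w _; rewrite /es patchE inS rs.
    by rewrite integral0_eq// => w _; rewrite /es patchE inS (negbTE rs).
  rewrite (fubini_tonelli (m1 := mu) (m2 := Pr) es mes es0).
  apply: eq_integral => w _; rewrite [RHS]integral_mkcond.
  by apply: eq_integral => r _; rewrite /es !patchE inS.
have phi_fin : (\int[mu]_(r in `[t, T]) phi r < +oo)%E.
  rewrite ge0_integral_sum//; last by move=> i; exact: measurable_funTS.
  apply/lte_sum_pinfty => i _.
  apply: (@le_lt_trans _ _ (\int[mu]_r \int[Pr]_w e i (r, w))%E).
    exact: ge0_subset_integral.
  rewrite -(fubini_tonelli1 (m1 := mu) (m2 := Pr) (e i) (me i) (e0 i)).
  pose b z := ((2 * \1_strip z + ut i z ^+ 2 + uh i z ^+ 2)%:E : \bar R).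
  have b1 : measurable_fun setT (fun z => (2 * \1_strip z : R)%:E).
    apply/measurable_EFinP; apply: measurable_funM => //; exact: measurable_indic.
  have b2 : measurable_fun setT (fun z => (ut i z ^+ 2)%:E).
    by apply/measurable_EFinP; exact: measurable_funX.
  have b3 : measurable_fun setT (fun z => (uh i z ^+ 2)%:E).
    by apply/measurable_EFinP; exact: measurable_funX.
  apply: (@le_lt_trans _ _ (\int[(mu \x Pr)%E]_z ((2 * \1_strip z : R)%:E
      + ((ut i z ^+ 2)%:E + (uh i z ^+ 2)%:E)))%E).
    apply: ge0_le_integral => //.
    - by apply: emeasurable_funD => //; exact: emeasurable_funD.
    - move=> z _; rewrite -!EFinD lee_fin indicE /ut /uh !patchE.
      case: ifPn => zs; last by rewrite subr0 normr0 expr0n mulr0 !addr0.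
      move: (u z.1 z.2 i ord0) (uhat z.1 z.2 i ord0) => y y'.
      have := sqr_ge0 (`|y| - 1 / 2); have := sqr_ge0 (`|y'| - 1 / 2).
      rewrite -(real_normK (num_real y)) -(real_normK (num_real y')) mulr1 !expr2.
      by have := ler_normB y y'; lra.
  have p1 z : [set: measurableTypeR R * Omega] z -> (0 <= (2 * \1_strip z : R)%:E)%E.
    by move=> _; rewrite lee_fin mulr_ge0.
  have p2 z : [set: measurableTypeR R * Omega] z -> (0 <= (ut i z ^+ 2)%:E)%E.
    by move=> _; rewrite lee_fin sqr_ge0.
  have p3 z : [set: measurableTypeR R * Omega] z -> (0 <= (uh i z ^+ 2)%:E)%E.
    by move=> _; rewrite lee_fin sqr_ge0.
  rewrite (ge0_integralD _ measurableT p1 b1 (fun z zT => adde_ge0 (p2 z zT) (p3 z zT))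
    (emeasurable_funD b2 b3)).
  rewrite (ge0_integralD _ measurableT p2 b2 p3 b3).
  apply: lte_add_pinfty; last first.
    apply: lte_add_pinfty.
      exact: le_lt_trans (admissible_sqr i u_adm) (ltry _).
    exact: le_lt_trans (admissible_sqr i uhat_admissible) (ltry _).
  under eq_integral do rewrite EFinM.
  have bi : measurable_fun setT (fun z : measurableTypeR R * Omega => (\1_strip z : R)%:E).
    by apply/measurable_EFinP; exact: measurable_indic.
  have bi0 z : [set: measurableTypeR R * Omega] z -> (0 <= (\1_strip z : R)%:E)%E.
    by move=> _; rewrite lee_fin.
  rewrite ge0_integralZl// ?lee_fin//.
  rewrite integral_indic//= setIT /strip product_measure1E//.
  rewrite [X in (_ * (_ * X) < _)%E](_ : _ = 1%E); last exact: probability_setT.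
  have fin : (lebesgue_measure (`[t, T]%classic : set R) < +oo)%E.
    by rewrite lebesgue_measure_itv/=; case: ifP => _; rewrite -?EFinD ltry.
  by rewrite mule1; apply: lte_mul_pinfty => //; rewrite lee_fin.
have [B B0 hB] := response_bound.
have phi_le s : t <= s <= T ->
    (phi s <= (N%:R * (C * B))%:E * \int[mu]_(r in `[t, s]) phi r)%E.
  move=> stT; rewrite phi_int.
  set I := (\sum_i \int[Pr]_w _)%E.
  have I0 : (0 <= I)%E by apply: sume_ge0 => i _; apply: integral_ge0 => w _; exact: integral_ge0.
  have mw i : measurable_fun setT (fun w => \int[mu]_(r in `[t, s]) e i (r, w))%E.
    pose es := (e i) \_ (`[t, s] `*` setT).
    have mes : measurable_fun setT es.
      apply/(measurable_restrictT _ (mS s)); exact: measurable_funTS.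
    have es0 z : (0 <= es z)%E by rewrite /es patchE; case: ifP.
    have := measurable_fun_fubini_tonelli_G (m1 := mu) es mes es0.
    apply: eq_measurable_fun => w _; rewrite /fubini_G [RHS]integral_mkcond.
    apply: eq_integral => r _; rewrite /es !patchE.
    have -> : ((r, w) \in `[t, s] `*` setT) = (r \in `[t, s]%classic) => //.
    by apply/idP/idP; rewrite !inE/= => // -[].
  have one i : (\int[Pr]_w e i (s, w) <= (C * B)%:E * I)%E.
    rewrite /I -ge0_integral_sum//; last first.
      by move=> j w _; exact: integral_ge0.
    have mS' : measurable_fun setT
        (fun w => \sum_j \int[mu]_(r in `[t, s]) e j (r, w))%E by exact: emeasurable_sum.
    have S0 w : setT w -> (0 <= \sum_j \int[mu]_(r in `[t, s]) e j (r, w))%E.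
      by move=> _; apply: sume_ge0 => j _; exact: integral_ge0.
    have CB0 : (0 <= (C * B)%:E)%E by rewrite lee_fin mulr_ge0.
    rewrite -(ge0_integralZl _ measurableT mS' S0 CB0).
    have mes' : measurable_fun setT (fun w => e i (s, w)).
      by apply: measurableT_comp (me i) _; exact: measurable_pair1.
    have CS0 w : setT w -> (0 <= (C * B)%:E * \sum_j \int[mu]_(r in `[t, s]) e j (r, w))%E.
      by move=> wT; apply: mule_ge0 => //; exact: S0.
    apply: ae_ge0_le_integral => //; first exact: measurable_funeM.
    apply: filterS2 u_int (uD s stT) => w wint wD _.
    rewrite eE//.
    have -> : u s w i ord0 - uhat s w i ord0 = (u s w - uhat s w) i ord0 by rewrite !mxE.
    rewrite wD mxE EFinM -muleA.
    apply: (@le_trans _ _ (C * \sum_j `|response u j s w|)%:E).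
      rewrite lee_fin mulr_sumr; apply: (le_trans (ler_norm_sum _ _ _)).
      by apply: ler_sum => j _; rewrite normrM [response_vec _ _ _ _ _]mxE ler_wpM2r// DC.
    rewrite EFinM; apply: lee_wpmul2l; first by rewrite lee_fin.
    rewrite -sumEFin ge0_sume_distrr; last by move=> j _; exact: integral_ge0.
    apply: lee_sum => j _; apply: (le_trans (hB u w j s stT (wint j))).
    apply: lee_wpmul2l; first by rewrite lee_fin.
    rewrite le_eqVlt; apply/orP; left; apply/eqP.
    apply: eq_integral => r; rewrite inE/= in_itv/= => /andP[tr rs].
    by rewrite eE// tr (le_trans rs)//; case/andP: stT.
  apply: (le_trans (lee_sum _ (fun i _ => one i))).
  rewrite -ge0_sume_distrl; last by move=> i _; rewrite lee_fin mulr_ge0.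
  by rewrite sumEFin sumr_const card_ord mulr_natl.
have NCB : 0 <= N%:R * (C * B) by rewrite mulr_ge0 ?ler0n// mulr_ge0.
have phi_zero := integral_gronwall NCB mphi phi0 phi_fin phi_le.
move=> s stT.
have : {ae Pr, forall w i, u s w i ord0 - uhat s w i ord0 = 0}.
  apply: ae_forall_fin => i.
  have mes' : measurable_fun setT (fun w => e i (s, w)).
    by apply: measurableT_comp (me i) _; exact: measurable_pair1.
  have e_zero : (\int[Pr]_w `|e i (s, w)| = 0)%E.
    transitivity (\int[Pr]_w e i (s, w))%E.
      by apply: eq_integral => w _; rewrite gee0_abs.
    apply/eqP; rewrite eq_le phii0 andbT -(phi_zero s stT) /phi (bigD1 i)//=.
    by rewrite leeDl// sume_ge0.
  have /(ae_eq_integral_abs Pr measurableT mes') := e_zero.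
  apply: filterS => w /(_ I); rewrite eE//= => -[] /eqP.
  by rewrite normr_eq0 => /eqP.
apply: filterS => w h; apply/matrixP => i j; rewrite (ord1 j).
by apply/eqP; rewrite -subr_eq0 h.
Qed.

End Model.
Theorem corollary5p1 (R : realType) (N : nat) (N_gt0 : (0 < N)%N)
  (disp : measure_display) (Omega : measurableType disp)
  (Pr : probability Omega R) (Pr_complete : measure_is_complete Pr)
  (t T : R) (t_ge0 : 0 <= t) (t_leT : t <= T)
  (W : 'I_N -> R -> {RV Pr >-> R}) (W_brownian : brownian T W)
  (tau : {RV Pr >-> R}) (tau_uniform : uniform01 tau)
  (tau_indep : independent_of tau (completed_natural_filtration W T))
  (a sigma : 'I_N -> R -> R)
  (a_cont : forall i, {within `[0, T], continuous (a i)})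
  (sigma_cont : forall i, {within `[0, T], continuous (sigma i)})
  (q : 'I_N -> 'I_N -> R) (q_ge0 : forall i j, 0 <= q i j)
  (gamma : 'I_N -> R) (gamma_ge0 : forall i, 0 <= gamma i)
  (d : 'cV[R]_N) (x : 'cV[R]_N) (L : R) (L_gt0 : 0 < L)
  (M0 : R -> 'M[R]_(N + N)) (M1 : R -> 'M[R]_((N + N) + (N + N)))
  (M2 : R -> 'cV[R]_((N + N) + (N + N))) (M3 : R -> R)
  (M_solves : system_M t T a sigma q gamma d M0 M1 M2 M3)
  (P : R -> 'M[R]_(N + N)) (p : R -> 'cV[R]_(N + N))
  (Pp_solves : reduced_R t T a q gamma d P p)
  (Xhat : R -> Omega -> 'cV[R]_(N + N)) (uhat : R -> Omega -> 'cV[R]_N)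
  (uhat_def : forall s w, t <= s <= T ->
     uhat s w = - (calB^T *m (P s *m Xhat s w + p s)))
  (Xhat_adapted : adapted (completed_natural_filtration W) t T Xhat)
  (Xhat_solves : solves_sde t T W (calA a) (fun s w => calB *m uhat s w)
     (Sigmabar sigma) (col_mx x 0) Xhat)
  (uhat_admissible :
     admissible Pr (completed_natural_filtration W) t T L uhat) :
  (forall F, is_F t T (completed_natural_filtration W) W tau a sigma x uhat F ->
     (forall s, t <= s <= T -> {ae Pr, forall w, F s w = calT *m Xhat s w}) /\
     feedback_relation Pr t T M0 M1 M2 uhat F) /\
  (forall u F,
     admissible Pr (completed_natural_filtration W) t T L u ->
     is_F t T (completed_natural_filtration W) W tau a sigma x u F ->
     feedback_relation Pr t T M0 M1 M2 u F ->
     forall s, t <= s <= T -> {ae Pr, forall w, u s w = uhat s w}).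
Proof.
have sub0 (f : R -> R) : {within `[0, T], continuous f} -> {within `[t, T], continuous f}.
  exact: within_continuous_sub_itv.
have a_cont' i : {within `[t, T], continuous (a i)} by exact: sub0.
have sigma_cont' i : {within `[t, T], continuous (sigma i)} by exact: sub0.
have /choice[al hal] : forall i, exists F : R -> R, {within `[t, T], continuous F} /\
    forall s, t < s < T -> is_derive s 1 F (a i s).
  by move=> i; have [F Fc dF] := antiderivative (@a_cont' i); exists F.
have al_cont i : {within `[t, T], continuous (al i)} by case: (hal i).
have al_derive i : forall s, t < s < T -> is_derive s 1 (al i) (a i s) by case: (hal i).
have gain := gain_identity a_cont' M_solves Pp_solves.
have repF := F_response t_ge0 t_leT W_brownian a_cont' sigma_cont' al_cont al_derive
  Xhat_solves Pr_complete tau_uniform tau_indep Xhat_adapted uhat_admissible.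
split=> [F FE|u F u_adm FE u_fb].
  have F_state s : t <= s <= T -> {ae Pr, forall w, F s w = calT *m Xhat s w}.
    move=> sT; apply: filterS (repF _ _ uhat_admissible FE s sT) => w ->.
    by rewrite response_self mulmx0 addr0.
  split=> // s sT; apply: filterS (F_state s sT) => w ->.
  have [gK gM] := gain s sT.
  by rewrite uhat_def// mulmxA gK gM mulmxDr opprD mulmxA.
have [X [Y [Xst Yst _]]] := FE.
have u_int : {ae Pr, forall w i, lebesgue_measure.-integrable `[t, T]
    (EFin \o (fun r => u r w i ord0 - uhat r w i ord0))}.
  apply: filterS (path_representation t_ge0 t_leT W_brownian a_cont' sigma_cont'
    al_cont al_derive Xhat_solves Xst Yst) => w h i.
  by case: (h i).
have [C C0 hC] := regular_on_bounded
  (regular_on_linear (linear_mulmx calB^T calB) (P_regular Pp_solves)).1.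
apply: (deviation_zero t_leT al_cont Pr_complete uhat_admissible
  (D := fun s => - (calB^T *m P s *m calB)) u_adm u_int C0).
  by move=> s sT i j; rewrite mxE normrN; exact: hC.
move=> s sT; apply: filterS2 (u_fb s sT) (repF _ _ u_adm FE s sT) => w -> ->.
have [gK gM] := gain s sT.
rewrite uhat_def// mulmxA gK gM !mulmxDr !mulmxA mulNmx.
by apply/matrixP => i j; rewrite !mxE; ring.
Qed.
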